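(* Let $k$ be a positive integer, $l\in\{0,1,\dots,k-1\}$, $\alpha_0,\dots,\alpha_l\in\omega_1\setminus\{0\}$, $\alpha_{l+1},\dots,\alpha_{k-1}\in\omega_1$ and $m_0,\dots,m_{k-1}\in\omega\setminus\{0\}$. Then \[P^{top}(\omega^{\alpha_0}\cdot(m_0+1),\dots,\omega^{\alpha_l}\cdot(m_l+1),\overline\omega[\alpha_{l+1},m_{l+1}],\dots,\overline\omega[\alpha_{k-1},m_{k-1}])\] is equal to either $\omega^\alpha\cdot m+1$ or $\omega^\alpha\cdot(m+1)$, where $\alpha=\alpha_0\#\alpha_1\#\cdots\#\alpha_{k-1}$ and $m=\sum_{i=0}^{k-1}(m_i-1)+1$.
   Context: Ordinals carry the order topology, subsets the subspace topology; arithmetic is ordinal arithmetic. For an ordinal $\alpha$ and $m\in\omega\setminus\{0\}$, $\overline\omega[\alpha,m]=\omega^\alpha\cdot m+1$ if $\alpha>0$ and $\overline\omega[\alpha,m]=m$ if $\alpha=0$. $P^{top}(\beta_0,\dots,\beta_{k-1})$ is the least ordinal $\beta$ such that for every $c:\beta\to\{0,\dots,k-1\}$ there exist $i$ and $X\subseteq c^{-1}(\{i\})$ homeomorphic to $\beta_i$. The natural sum $\alpha\#\beta$: write $\alpha=\sum_j\omega^{\gamma_j}l_j$, $\beta=\sum_j\omega^{\gamma_j}m_j$ with common decreasing exponents and $l_j,m_j\in\omega$; then $\alpha\#\beta=\sum_j\omega^{\gamma_j}(l_j+m_j)$. *)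

(* Defs.v *)
From HB Require Import structures.
From mathcomp Require Import all_boot all_order.
From mathcomp Require Import generic_quotient.
From mathcomp Require Import all_classical.
From mathcomp Require Import topology.

Set Implicit Arguments.
Unset Strict Implicit.
Unset Printing Implicit Defensive.

Import Order.TTheory.
Local Open Scope order_scope.
Local Open Scope classical_set_scope.
Local Open Scope quotient_scope.

(* Ordinals are well-founded trees up to equality of rank: [Node f] denotes the
   least ordinal strictly above every [f i].  Since the branching types range
   over a whole universe, these are all the ordinals of that universe. *)
Inductive tree : Type := Node (A : Type) of (A -> tree).

Fixpoint tle (x y : tree) {struct x} : Prop :=
  match x, y with
  | Node A f, Node B g => forall i, exists j, tle (f i) (g j)
  end.

Definition tlt (x y : tree) : Prop :=
  match y with Node B g => exists j, tle x (g j) end.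

Lemma tle_refl x : tle x x.
Proof. by elim: x => A f IH i; exists i; exact: IH. Qed.

Lemma tle_trans y x z : tle x y -> tle y z -> tle x z.
Proof.
elim: x y z => I f IH [J g] [K h] /= xy yz i.
have [j fg] := xy i; have [l gh] := yz j; exists l; exact: IH fg gh.
Qed.

Lemma tle_or_tlt x y : tle x y \/ tlt y x.
Proof.
suff: (tle x y \/ tlt y x) /\ (tlt x y \/ tle y x) by case.
elim: x y => I f IHx; elim => J g IHy; split.
- have [[i fi]|/forallNP H] := pselect (exists i, tle (Node g) (f i)).
    by right; exists i.
  by left => i; have [_ [|/H//]] := IHx i (Node g).
- have [[j gj]|/forallNP H] := pselect (exists j, tle (Node f) (g j)).
    by left; exists j.
  by right => j; have [[/H//|]] := IHy j.
Qed.

Lemma tleP A (f : A -> tree) y : tle (Node f) y <-> forall i, tlt (f i) y.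
Proof. by case: y. Qed.

Lemma tlt_irr x : ~ tlt x x.
Proof. by elim: x => A f IH [i /tleP/(_ i)]; exact: IH. Qed.

Lemma tlt_le_trans y x z : tlt x y -> tle y z -> tlt x z.
Proof.
case: y => B g [j xg] /tleP/(_ j); case: z => C h [k gh].
by exists k; exact: tle_trans xg gh.
Qed.

Lemma tle_lt_trans y x z : tle x y -> tlt y z -> tlt x z.
Proof. by case: z => K h xy [k yh]; exists k; exact: tle_trans xy yh. Qed.

Lemma tltW x y : tlt x y -> tle x y.
Proof.
elim: x y => A f IH [B g] [j fg]; apply/tleP => i; exists j; apply: IH.
by move/tleP : fg.
Qed.

HB.instance Definition _ := gen_eqMixin tree.
HB.instance Definition _ := gen_choiceMixin tree.

Definition teq (x y : tree) : bool := `[< tle x y /\ tle y x >].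

Lemma teq_refl : reflexive teq.
Proof. by move=> x; apply/asboolP; split; exact: tle_refl. Qed.

Lemma teq_sym : symmetric teq.
Proof. by move=> x y; apply/asboolP/asboolP => -[]. Qed.

Lemma teq_trans : transitive teq.
Proof.
move=> y x z /asboolP[xy yx] /asboolP[yz zy]; apply/asboolP.
by split; [exact: tle_trans xy yz|exact: tle_trans zy yx].
Qed.

Canonical teq_equiv := EquivRel teq teq_refl teq_sym teq_trans.

Definition Ord : Type := {eq_quot teq}.

HB.instance Definition _ := Choice.on Ord.
HB.instance Definition _ := Quotient.on Ord.

Definition ord_of (x : tree) : Ord := \pi_Ord x.

Lemma ord_ofP x y : ord_of x = ord_of y <-> tle x y /\ tle y x.
Proof.
rewrite /ord_of; split; first by move/eqmodP/asboolP.
by move=> xy; apply/eqmodP/asboolP.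
Qed.

Lemma repr_ord_of x : tle (repr (ord_of x)) x /\ tle x (repr (ord_of x)).
Proof. by apply/ord_ofP; rewrite /ord_of reprK. Qed.

Lemma ord_ofK a : ord_of (repr a) = a.
Proof. exact: reprK. Qed.

Definition leo (a b : Ord) : bool := `[< tle (repr a) (repr b) >].

Definition lto (a b : Ord) : bool := (b != a) && leo a b.

Fact leo_refl : reflexive leo.
Proof. by move=> a; apply/asboolP; exact: tle_refl. Qed.

Fact leo_anti : antisymmetric leo.
Proof.
move=> a b /andP[/asboolP ab /asboolP ba].
by rewrite -(ord_ofK a) -(ord_ofK b); apply/ord_ofP.
Qed.

Fact leo_trans : transitive leo.
Proof.
move=> b a c /asboolP ab /asboolP bc; apply/asboolP; exact: tle_trans ab bc.
Qed.

Fact leo_total : total leo.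
Proof.
move=> a b; apply/orP.
have [ab|/tltW ba] := tle_or_tlt (repr a) (repr b); [left|right]; exact/asboolP.
Qed.

Fact ordinal_display : Order.disp_t.
Proof. exact: Order.Disp tt tt. Qed.

HB.instance Definition _ := @Order.isPOrder.Build ordinal_display Ord leo lto
  (fun _ _ => erefl) leo_refl leo_anti leo_trans.
HB.instance Definition _ := @Order.POrder_isTotal.Build ordinal_display Ord leo_total.

Lemma le_ord_of x y : (ord_of x <= ord_of y) <-> tle x y.
Proof.
have [x1 x2] := repr_ord_of x; have [y1 y2] := repr_ord_of y.
split; first by move/asboolP => xy; apply: tle_trans (tle_trans x2 xy) y1.
by move=> xy; apply/asboolP; apply: tle_trans (tle_trans x1 xy) y2.
Qed.

Lemma lt_ord_of x y : (ord_of x < ord_of y) <-> tlt x y.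
Proof.
rewrite ltNge; split => [/negP xy|xy].
  by have [/le_ord_of//|] := tle_or_tlt y x.
by apply/negP => /le_ord_of yx; exact: tlt_irr (tlt_le_trans xy yx).
Qed.

Lemma lt_ord_wf : well_founded (fun a b : Ord => a < b).
Proof.
suff H x y : tle y x -> Acc (fun a b : Ord => a < b) (ord_of y).
  by move=> a; rewrite -(ord_ofK a); apply: H; exact: tle_refl.
elim: x y => A f IH y yf; constructor => a; rewrite -(ord_ofK a) => /lt_ord_of.
by move=> /tlt_le_trans/(_ yf)[i]; exact: IH.
Qed.

Definition tdom (x : tree) : Type := let: Node A _ := x in A.

Definition tsub (x : tree) : tdom x -> tree := let: Node A f := x in f.

Definition tsup (A : Type) (h : A -> tree) : tree :=
  Node (fun u : {i : A & tdom (h i)} => tsub (projT2 u)).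

Definition tmax (x y : tree) : tree := tsup (fun b : bool => if b then x else y).

Definition tsucc (x : tree) : tree := Node (fun _ : unit => x).

Definition tnat (n : nat) : tree := iter n tsucc (Node (of_void tree)).

Definition tomega : tree := Node tnat.

Fixpoint tadd (x y : tree) {struct y} : tree :=
  match y with Node B g => tmax x (Node (fun j => tadd x (g j))) end.

Fixpoint tmul (x y : tree) {struct y} : tree :=
  match y with Node B g => tsup (fun j => tadd (tmul x (g j)) x) end.

Fixpoint texp_omega (y : tree) : tree :=
  match y with
  | Node B g => tmax (tnat 1) (tsup (fun j => tmul (texp_omega (g j)) tomega))
  end.

(* Lifted through representatives; [addo_leP], [mulo_leP], [omega_exp_leP] and
   the zero, successor and limit clauses below show that these are the usual
   operations. *)
Definition nato (n : nat) : Ord := ord_of (tnat n).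

Definition omega : Ord := ord_of tomega.

Definition addo (a b : Ord) : Ord := ord_of (tadd (repr a) (repr b)).

Definition mulo (a b : Ord) : Ord := ord_of (tmul (repr a) (repr b)).

Definition omega_exp (a : Ord) : Ord := ord_of (texp_omega (repr a)).

Declare Scope ord_scope.
Delimit Scope ord_scope with ORD.
Bind Scope ord_scope with Ord.
Notation "n %:O" := (nato n) (at level 1, left associativity, format "n %:O") : ord_scope.
Notation "a + b" := (addo a b) : ord_scope.
Notation "a * b" := (mulo a b) : ord_scope.
Notation "'omega^' a" := (omega_exp a) (at level 30, right associativity) : ord_scope.
Local Open Scope ord_scope.

Lemma tltP x y : tlt x y <-> exists j : tdom y, tle x (tsub j).
Proof. by case: y. Qed.

Lemma tle_tsup A (h : A -> tree) w : tle (tsup h) w <-> forall i, tle (h i) w.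
Proof.
rewrite tleP; split => [H i|H [i j] /=].
  case E : (h i) => [B g]; apply/tleP => j.
  have : forall (j : tdom (h i)), tlt (tsub j) w by move=> k; exact: (H (existT _ i k)).
  by rewrite E; apply.
by apply: tlt_le_trans (H i); apply/tltP; exists j; exact: tle_refl.
Qed.

Lemma tle_tmax x y w : tle (tmax x y) w <-> tle x w /\ tle y w.
Proof.
rewrite tle_tsup; split => [H|[xw yw] []//].
by split; [exact: (H true)|exact: (H false)].
Qed.

Lemma tle_tadd x B (g : B -> tree) w :
  tle (tadd x (Node g)) w <-> tle x w /\ forall j, tlt (tadd x (g j)) w.
Proof. by rewrite -[tadd _ _]/(tmax _ _) tle_tmax tleP. Qed.

Lemma tadd_le2 x x' y y' : tle x x' -> tle y y' -> tle (tadd x y) (tadd x' y').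
Proof.
move=> xx'; elim: y y' => B g IH [C h] gh; apply/tle_tadd.
have [xh H] := (tle_tadd x' h (tadd x' (Node h))).1 (tle_refl _).
split => [|j]; first exact: tle_trans xx' xh.
have [k gk] := gh j; exact: tle_lt_trans (IH j _ gk) (H k).
Qed.

Lemma tle_tmul x B (g : B -> tree) w :
  tle (tmul x (Node g)) w <-> forall j, tle (tadd (tmul x (g j)) x) w.
Proof. exact: tle_tsup. Qed.

Lemma tmul_le2 x x' y y' : tle x x' -> tle y y' -> tle (tmul x y) (tmul x' y').
Proof.
move=> xx'; elim: y y' => B g IH [C h] gh; apply/tle_tmul => j.
have H := (tle_tmul x' h (tmul x' (Node h))).1 (tle_refl _).
have [k gk] := gh j; apply: tle_trans (H k).
by apply: tadd_le2 => //; exact: IH.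
Qed.

Lemma tle_texp B (g : B -> tree) w :
  tle (texp_omega (Node g)) w <->
  tle (tnat 1) w /\ forall j, tle (tmul (texp_omega (g j)) tomega) w.
Proof. by rewrite -[texp_omega _]/(tmax _ _) tle_tmax tle_tsup. Qed.

Lemma texp_le x y : tle x y -> tle (texp_omega x) (texp_omega y).
Proof.
elim: x y => A f IH [B g] fg; apply/tle_texp.
have [g1 H] := (tle_texp g (texp_omega (Node g))).1 (tle_refl _).
split => // i; have [j ij] := fg i; apply: tle_trans (H j).
by apply: tmul_le2; [exact: IH|exact: tle_refl].
Qed.

Lemma addo_ord_of x y : addo (ord_of x) (ord_of y) = ord_of (tadd x y).
Proof.
have [x1 x2] := repr_ord_of x; have [y1 y2] := repr_ord_of y.
by apply/ord_ofP; split; apply: tadd_le2.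
Qed.

Lemma mulo_ord_of x y : mulo (ord_of x) (ord_of y) = ord_of (tmul x y).
Proof.
have [x1 x2] := repr_ord_of x; have [y1 y2] := repr_ord_of y.
by apply/ord_ofP; split; apply: tmul_le2.
Qed.

Lemma omega_exp_ord_of x : omega_exp (ord_of x) = ord_of (texp_omega x).
Proof.
have [x1 x2] := repr_ord_of x.
by apply/ord_ofP; split; apply: texp_le.
Qed.

Lemma forall_lt_ord_of B (g : B -> tree) (P : Ord -> Prop) :
  (forall a b, a <= b -> P b -> P a) ->
  (forall a, a < ord_of (Node g) -> P a) <-> forall j, P (ord_of (g j)).
Proof.
move=> mP; split => [H j|H a].
  by apply: H; apply/lt_ord_of; exists j; exact: tle_refl.
rewrite -(ord_ofK a) => /lt_ord_of[j aj].
by apply: mP (H j); apply/le_ord_of.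
Qed.

Lemma addo_le2 a a' b b' : a <= a' -> b <= b' -> a + b <= a' + b'.
Proof.
rewrite -(ord_ofK a) -(ord_ofK a') -(ord_ofK b) -(ord_ofK b') !addo_ord_of.
by move=> /le_ord_of aa' /le_ord_of bb'; apply/le_ord_of/tadd_le2.
Qed.

Lemma mulo_le2 a a' b b' : a <= a' -> b <= b' -> a * b <= a' * b'.
Proof.
rewrite -(ord_ofK a) -(ord_ofK a') -(ord_ofK b) -(ord_ofK b') !mulo_ord_of.
by move=> /le_ord_of aa' /le_ord_of bb'; apply/le_ord_of/tmul_le2.
Qed.

Lemma omega_exp_le a b : a <= b -> omega^ a <= omega^ b.
Proof.
rewrite -(ord_ofK a) -(ord_ofK b) !omega_exp_ord_of.
by move=> /le_ord_of ab; apply/le_ord_of/texp_le.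
Qed.

(* a + b = max (a, sup_(b' < b) (a + b' + 1)) *)
Lemma addo_leP a b c :
  a + b <= c <-> a <= c /\ forall b', b' < b -> a + b' < c.
Proof.
rewrite -(ord_ofK b); case: (repr b) => B g; rewrite forall_lt_ord_of; last first.
  by move=> b1 b2 b12; apply: le_lt_trans; exact: addo_le2.
rewrite -(ord_ofK a) -(ord_ofK c) addo_ord_of !le_ord_of tle_tadd.
split => -[ac H]; split => // j; first by rewrite addo_ord_of; exact/lt_ord_of.
by move: (H j); rewrite addo_ord_of => /lt_ord_of.
Qed.

(* a * b = sup_(b' < b) (a * b' + a) *)
Lemma mulo_leP a b c :
  a * b <= c <-> forall b', b' < b -> a * b' + a <= c.
Proof.
rewrite -(ord_ofK b); case: (repr b) => B g; rewrite forall_lt_ord_of; last first.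
  by move=> b1 b2 b12; apply: le_trans; apply: addo_le2 => //; exact: mulo_le2.
rewrite -(ord_ofK a) -(ord_ofK c) mulo_ord_of !le_ord_of tle_tmul.
split => H j; first by rewrite mulo_ord_of addo_ord_of; exact/le_ord_of.
by move: (H j); rewrite mulo_ord_of addo_ord_of => /le_ord_of.
Qed.

(* omega ^ b = max (1, sup_(b' < b) (omega ^ b' * omega)) *)
Lemma omega_exp_leP b c :
  omega^ b <= c <->
  1%:O <= c /\ forall b', b' < b -> omega^ b' * omega <= c.
Proof.
rewrite -(ord_ofK b); case: (repr b) => B g; rewrite forall_lt_ord_of; last first.
  by move=> b1 b2 b12; apply: le_trans; apply: mulo_le2 => //; exact: omega_exp_le.
rewrite -(ord_ofK c) omega_exp_ord_of !le_ord_of tle_texp.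
split => -[c1 H]; split => // j.
  by rewrite omega_exp_ord_of mulo_ord_of; exact/le_ord_of.
by move: (H j); rewrite omega_exp_ord_of mulo_ord_of => /le_ord_of.
Qed.

Lemma eq_leo (a b : Ord) : (forall c, a <= c <-> b <= c) -> a = b.
Proof. by move=> H; apply/le_anti; rewrite (H b).2 ?(H a).1. Qed.

Lemma le0o a : 0%:O <= a.
Proof. by rewrite -(ord_ofK a); apply/le_ord_of/tleP => -[]. Qed.

Lemma natoS_leP n c : n.+1%:O <= c <-> n%:O < c.
Proof.
by rewrite -(ord_ofK c) le_ord_of lt_ord_of tleP; split => [/(_ tt)|+ []].
Qed.

Lemma lto1 a : a < 1%:O -> a = 0%:O.
Proof.
move=> a1; apply/le_anti; rewrite le0o andbT leNgt.
by apply/negP => /natoS_leP; rewrite leNgt a1.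
Qed.

Lemma lt_omegaP a : a < omega <-> exists n, a = n%:O.
Proof.
split=> [|[n ->]]; last by apply/lt_ord_of; exists n; exact: tle_refl.
rewrite -{1}(ord_ofK a) => /lt_ord_of[n /le_ord_of]; rewrite ord_ofK -/(nato n).
elim: n => [a0|n IH]; first by exists 0; apply/le_anti; rewrite a0 le0o.
rewrite le_eqVlt => /predU1P[->|an]; first by exists n.+1.
by apply: IH; rewrite leNgt; apply/negP => /natoS_leP; rewrite leNgt an.
Qed.

Lemma addo0 a : a + 0%:O = a.
Proof.
apply: eq_leo => c; rewrite addo_leP; split=> [[]//|ac]; split => // b.
by rewrite ltNge le0o.
Qed.

Lemma succo_leP b c : b + 1%:O <= c <-> b < c.
Proof.
rewrite addo_leP; split => [[_ /(_ (nato 0))]|bc].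
  by rewrite addo0; apply; exact/natoS_leP.
by split => [|b' /lto1->]; [exact: ltW|rewrite addo0].
Qed.

Lemma lt_succoP a b : a < b + 1%:O <-> a <= b.
Proof.
rewrite ltNge (leNgt a b); split => /negP H; apply/negP; first by move/succo_leP.
by move/succo_leP.
Qed.

Lemma natoS n : n.+1%:O = n%:O + 1%:O.
Proof. by apply: eq_leo => c; rewrite succo_leP natoS_leP. Qed.

Lemma addoS a b : a + (b + 1%:O) = a + b + 1%:O.
Proof.
apply: eq_leo => c; rewrite succo_leP addo_leP; split => [[_]|abc].
  by apply; apply/lt_succoP.
split=> [|b' /lt_succoP b'b]; last by apply: le_lt_trans abc; exact: addo_le2.
by apply/ltW; apply: le_lt_trans abc; have [] := (addo_leP a b _).1 (lexx _).
Qed.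

Definition limito (b : Ord) : Prop :=
  0%:O < b /\ forall c, c < b -> c + 1%:O < b.

Lemma addo_lim a b : limito b ->
  isLub [set a + c | c in [set c | c < b]] (a + b).
Proof.
move=> [b0 bS]; split => [_ [c cb <-]|d ubd].
  by apply: addo_le2 => //; exact: ltW.
apply/addo_leP; split => [|c cb]; first by apply: ubd; exists (nato 0); rewrite ?addo0.
by apply/succo_leP; rewrite -addoS; apply: ubd; exists (addo c (nato 1)) => //; exact: bS.
Qed.

Lemma mulo0 a : a * 0%:O = 0%:O.
Proof.
apply: eq_leo => c; rewrite mulo_leP; split => [_|_ b]; first exact: le0o.
by rewrite ltNge le0o.
Qed.

Lemma muloS a b : a * (b + 1%:O) = a * b + a.
Proof.
apply: eq_leo => c; rewrite mulo_leP; split => [|abc b' /lt_succoP b'b].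
  by apply; exact/lt_succoP.
by apply: le_trans abc; apply: addo_le2 => //; exact: mulo_le2.
Qed.

Lemma mulo_lim a b : limito b ->
  isLub [set a * c | c in [set c | c < b]] (a * b).
Proof.
move=> [b0 bS]; split => [_ [c cb <-]|d ubd].
  by apply: mulo_le2 => //; exact: ltW.
apply/mulo_leP => c cb; rewrite -muloS.
by apply: ubd; exists (addo c (nato 1)) => //; exact: bS.
Qed.

Lemma omega_exp0 : omega^ 0%:O = 1%:O.
Proof.
apply: eq_leo => c; rewrite omega_exp_leP; split => [[]//|]; split => // b.
by rewrite ltNge le0o.
Qed.

Lemma omega_expS b : omega^ (b + 1%:O) = omega^ b * omega.
Proof.
apply: eq_leo => c; rewrite omega_exp_leP; split => [[_]|bc].
  by apply; exact/lt_succoP.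
split => [|b' /lt_succoP b'b]; last first.
  by apply: le_trans bc; apply: mulo_le2 => //; exact: omega_exp_le.
have [b1 _] := (omega_exp_leP b _).1 (lexx _).
apply: le_trans bc; apply: (@le_trans _ _ (addo (mulo (omega_exp b) (nato 0)) (omega_exp b))).
  by apply: le_trans (addo_le2 (le0o _) b1); apply/natoS_leP/succo_leP.
by apply: ((mulo_leP _ _ _).1 (lexx _)); apply/lt_omegaP; exists 0.
Qed.

Lemma omega_exp_lim b : limito b ->
  isLub [set omega^ c | c in [set c | c < b]] (omega^ b).
Proof.
move=> [b0 bS]; split => [_ [c cb <-]|d ubd].
  by apply: omega_exp_le; exact: ltW.
apply/omega_exp_leP; split => [|c cb].
  by rewrite -omega_exp0; apply: ubd; exists (nato 0).
rewrite -omega_expS; apply: ubd; exists (addo c (nato 1)) => //; exact: bS.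
Qed.

Definition segment (b : Ord) : Type := {x : Ord | x < b}.

HB.instance Definition _ b := Choice.on (segment b).
HB.instance Definition _ b := SubType.on (segment b).
HB.instance Definition _ b :=
  [SubChoice_isSubOrder of segment b by <: with ordinal_display].
HB.instance Definition _ b :=
  Topological.copy (segment b) (order_topology (segment b)).
HB.instance Definition _ b :=
  Order_isNbhs.Build _ (segment b) (@order_nbhs_itv _ (segment b)).

Definition homeomorphic (S T : topologicalType) : Prop :=
  exists (f : S -> T) (g : T -> S),
    [/\ cancel f g, cancel g f, continuous f & continuous g].

Definition top_arrow (k : nat) (beta : Ord) (b : 'I_k -> Ord) : Prop :=
  forall c : segment beta -> 'I_k,
  exists (i : 'I_k) (X : set (segment beta)),
    X `<=` c @^-1` [set i] /\ homeomorphic (set_type X) (segment (b i)).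

Definition is_Ptop (k : nat) (b : 'I_k -> Ord) (beta : Ord) : Prop :=
  top_arrow beta b /\ forall beta', top_arrow beta' b -> beta <= beta'.

Definition bar_omega (a : Ord) (m : nat) : Ord :=
  if 0%:O < a then omega^ a * m%:O + 1%:O else m%:O.

(* Zero coefficients are allowed, so that two ordinals can share the exponents
   [g]; [i < j] gives [g j < g i], so the sum starts with the largest power. *)
Definition is_natural_sum (a b s : Ord) : Prop :=
  exists (n : nat) (g : 'I_n -> Ord) (l m : 'I_n -> nat),
    [/\ {homo g : i j / (i < j)%N >-> j < i},
        a = \big[addo/0%:O]_(j < n) (omega^ (g j) * (l j)%:O),
        b = \big[addo/0%:O]_(j < n) (omega^ (g j) * (m j)%:O) &
        s = \big[addo/0%:O]_(j < n) (omega^ (g j) * (l j + m j)%N%:O)].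

(* Cantor normal forms exist and are unique, so [is_natural_sum a b] has exactly
   one element and the default value 0 is never used. *)
Definition natural_sum (a b : Ord) : Ord := xget 0%:O (is_natural_sum a b).

(* omega_1, the least uncountable ordinal, is the set of countable ordinals. *)
Definition in_omega1 (a : Ord) : Prop := countable [set x | x < a].

(* Main.v *)
Require Import Defs.
From mathcomp Require Import all_boot all_order interval all_classical topology.
Import Order.TTheory.
Local Open Scope order_scope.
Local Open Scope classical_set_scope.
Local Open Scope ord_scope.

Set Implicit Arguments.
Unset Strict Implicit.
Unset Printing Implicit Defensive.

(** Lower bound: [alpha] is a disjoint union of sets of order
types [alpha_ i], so colouring each point of [omega^ alpha * m] of Cantor-Bendixson
rank [d < alpha] by the part that contains [d] leaves only [m - 1] points of rank
[alpha], which are coloured [i] at most [m_ i - 1] times.  A copy of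
[omega^ (alpha_ i) * m_ i + 1] in colour [i] would need [m_ i] such points.

Upper bound: the rank of a point is at most the natural sum over [i] of its ranks
relative to the colour classes, because near that point all the smaller ranks occur
and a nearby point of colour [i] has a smaller [i]-th rank.  Hence at each
[omega^ alpha * j], [1 <= j <= m + 1], either some [i]-th rank exceeds [alpha_ i], and
then colour [i] contains copies of every [omega^ (alpha_ i) * n + 1], or all the [i]-th
ranks equal [alpha_ i].  In the latter case [m_ i] of the first [m] points have the
same colour [i], and the end point [omega^ alpha * (m + 1)], which is not in the space,
provides the last summand [omega^ (alpha_ i)].  In countable ordinals a point of rank
[d] relative to a set is the limit of a closed copy of [omega^ d] in that set.

An ordinal strictly between [omega^ alpha * m + 1] and [omega^ alpha * (m + 1)] embeds
in the former, by exchanging two clopen parts. *)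

Implicit Types a b c d g : Ord.

(** * Ordinal arithmetic *)

Lemma ord_ind (P : Ord -> Prop) :
  (forall a, (forall b, b < a -> P b) -> P a) -> forall a, P a.
Proof. exact: (well_founded_ind lt_ord_wf). Qed.

Lemma ord_min (P : Ord -> Prop) :
  (exists a, P a) -> exists2 a, P a & forall b, b < a -> ~ P b.
Proof.
move=> [a]; elim/ord_ind: a => a IH Pa.
have [[b ba Pb]|nP] := pselect (exists2 b, b < a & P b); first exact: IH Pb.
by exists a => // b ba Pb; apply: nP; exists b.
Qed.

Lemma leo_sub a b : (forall c, c < a -> c < b) -> a <= b.
Proof. by move=> H; rewrite leNgt; apply/negP => /H; rewrite ltxx. Qed.

Lemma gt0o a : (0%:O < a) = (a != 0%:O).
Proof. by rewrite lt_neqAle le0o andbT eq_sym. Qed.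

Lemma lto_add2l a b c : b < c -> a + b < a + c.
Proof. by have [_] := (addo_leP a c (a + c)).1 (lexx _); apply. Qed.

Lemma leo_addr2 a b c : (a + b <= a + c) = (b <= c).
Proof.
by apply/idP/idP => [|bc]; [apply: contraTT; rewrite -!ltNge; exact: lto_add2l|exact: addo_le2].
Qed.

Lemma lto_addr2 a b c : (a + b < a + c) = (b < c).
Proof. by rewrite !ltNge leo_addr2. Qed.

Lemma addo_inj a : injective (addo a).
Proof. by move=> b c bc; apply/le_anti; rewrite -(leo_addr2 a b) -(leo_addr2 a c) bc lexx. Qed.

Lemma leo_addl a b : a <= a + b.
Proof. by rewrite -{1}(addo0 a) leo_addr2 le0o. Qed.

Lemma leo_addr a b : b <= a + b.
Proof.
elim/ord_ind: b => b IH; apply: leo_sub => c cb.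
by apply: le_lt_trans (IH _ cb) _; exact: lto_add2l.
Qed.

Lemma leo_exists_sub a c : a <= c -> exists b, c = a + b.
Proof.
move=> ac; have [|b cab bmin] := @ord_min (fun b => c <= a + b).
  by exists c; exact: leo_addr.
exists b; apply/le_anti; rewrite cab; apply/addo_leP; split => // b' /bmin.
by move/negP; rewrite -ltNge.
Qed.

Lemma lto_addE a b c : c < a + b -> c < a \/ exists2 d, d < b & c = a + d.
Proof.
move=> cab; have [ca|] := ltP c a; first by left.
by move=> /leo_exists_sub[d cE]; right; exists d => //; rewrite -(lto_addr2 a) -cE.
Qed.

(** Left subtraction: for [a <= c] it is the only [b] with [c = a + b]; for [c < a] it is a default
    value. *)
Definition subo (c a : Ord) : Ord := xget 0%:O [set b | c = a + b].

Lemma suboK a b : subo (a + b) a = b.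
Proof. by rewrite /subo; case: xgetP => [d _ /addo_inj->|/(_ b)[]]. Qed.

Lemma addoA a b c : a + (b + c) = a + b + c.
Proof.
elim/ord_ind: c => c IH; apply/le_anti/andP; split; apply/addo_leP; split.
- exact: le_trans (leo_addl _ _) (leo_addl _ _).
- move=> d /lto_addE[db|[e ec ->]]; last by rewrite IH // lto_addr2.
  by apply: lt_le_trans (leo_addl _ _); rewrite lto_addr2.
- by rewrite leo_addr2 leo_addl.
- by move=> d dc; rewrite -IH // !lto_addr2.
Qed.

Lemma add0o a : 0%:O + a = a.
Proof.
apply/le_anti; rewrite leo_addr andbT; elim/ord_ind: a => a IH.
by apply/addo_leP; split => [|b ba]; [exact: le0o|exact: le_lt_trans (IH _ ba) ba].
Qed.

Lemma lto_addl a b : 0%:O < b -> a < a + b.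
Proof. by move=> b0; rewrite -{1}(addo0 a) lto_addr2. Qed.

Lemma lt_nato n m : (n%:O < m%:O) = (n < m)%N.
Proof.
elim: m n => [|m IH] n; first by rewrite ltn0 ltNge le0o.
case: n => [|n]; first by rewrite ltn0Sn natoS; apply/lt_succoP/le0o.
by rewrite ltnS -IH (natoS m); apply/idP/idP => [/lt_succoP/natoS_leP|/natoS_leP/lt_succoP].
Qed.

Lemma le_nato n m : (n%:O <= m%:O) = (n <= m)%N.
Proof. by rewrite leNgt lt_nato -leqNgt. Qed.

Lemma nato_inj : injective nato.
Proof. by move=> n m nm; apply/eqP; rewrite eqn_leq -!le_nato nm lexx. Qed.

Lemma mulon0 a : a * 0%N%:O = 0%:O.
Proof. exact: mulo0. Qed.

Lemma mulonS a n : a * n.+1%:O = a * n%:O + a.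
Proof. by rewrite natoS muloS. Qed.

Lemma mulon1 a : a * 1%:O = a.
Proof. by rewrite mulonS mulo0 add0o. Qed.

Lemma mulonD a n m : a * (n + m)%N%:O = a * n%:O + a * m%:O.
Proof.
elim: m => [|m IH]; first by rewrite addn0 mulo0 addo0.
by rewrite addnS !mulonS IH addoA.
Qed.

Lemma mulon_le a n m : (n <= m)%N -> a * n%:O <= a * m%:O.
Proof. by move=> nm; apply: mulo_le2 => //; rewrite le_nato. Qed.

Lemma mulon_lt a n m : 0%:O < a -> (n < m)%N -> a * n%:O < a * m%:O.
Proof.
move=> a0 /(mulon_le a); apply: lt_le_trans.
by rewrite mulonS lto_addl.
Qed.

Lemma add1on n : 1%:O + n%:O = n.+1%:O.
Proof. by elim: n => [|n IH]; rewrite ?addo0 // (natoS n) addoS IH -natoS. Qed.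

Lemma omega_exp_gt0 g : 0%:O < omega^ g.
Proof. by apply/natoS_leP; have [] := (omega_exp_leP g _).1 (lexx _). Qed.

Lemma mulon_lt_omega a n : 0%:O < a -> a * n%:O < a * omega.
Proof.
move=> a0; apply: lt_le_trans (lto_addl _ a0) _.
by apply: (mulo_leP _ _ _).1 (lexx _) _ _; apply/lt_omegaP; exists n.
Qed.

Lemma omega_exp_mulon_lt g g' n : g < g' -> omega^ g * n%:O < omega^ g'.
Proof.
move=> gg'; apply: lt_le_trans (mulon_lt_omega _ (omega_exp_gt0 g)) _.
by have [_] := (omega_exp_leP g' _).1 (lexx _); apply.
Qed.

Lemma omega_exp_lt g g' : g < g' -> omega^ g < omega^ g'.
Proof. by move=> /(omega_exp_mulon_lt 1); rewrite mulon1. Qed.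

Lemma omega_exp_lt_inv g g' : omega^ g < omega^ g' -> g < g'.
Proof. by rewrite !ltNge; apply: contra; exact: omega_exp_le. Qed.

(** If a nonzero [x] were at least every [omega^ g' * n] with [g' < g], it would bound [omega^ g] by
    [omega_exp_leP]. This treats successor and limit exponents alike. *)
Lemma lto_omega_exp g x : x < omega^ g ->
  x = 0%:O \/ exists2 g', g' < g & exists n, x < omega^ g' * n%:O.
Proof.
move=> xg; have [x1|x1] := ltP x 1%:O; first by left; exact: lto1.
right; apply: contrapT => H; move: xg; apply/negP; rewrite -leNgt.
apply/omega_exp_leP; split => // g' g'g; apply/mulo_leP => _ /lt_omegaP[n ->].
rewrite leNgt; apply/negP => xlt; apply: H; exists g' => //; exists n.+1.
by rewrite mulonS.
Qed.

(** Additive indecomposability: both summands lie below finite multiples of one smaller power. *)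
Lemma addo_lt_omega_exp g x y : x < omega^ g -> y < omega^ g -> x + y < omega^ g.
Proof.
move=> xg yg; have [->|[g1 g1g [n1 x1]]] := lto_omega_exp xg; first by rewrite add0o.
have [->|[g2 g2g [n2 y2]]] := lto_omega_exp yg; first by rewrite addo0.
pose h := Order.max g1 g2; have hg : h < g by rewrite gt_max g1g.
apply: le_lt_trans (omega_exp_mulon_lt (n1 + n2) hg); rewrite mulonD.
apply: addo_le2.
- apply: le_trans (ltW x1) _; apply: mulo_le2 => //; apply: omega_exp_le.
  by rewrite le_max lexx.
- apply: le_trans (ltW y2) _; apply: mulo_le2 => //; apply: omega_exp_le.
  by rewrite le_max lexx orbT.
Qed.

Lemma addo_omega_exp g x : x < omega^ g -> x + omega^ g = omega^ g.
Proof.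
move=> xg; apply/le_anti; rewrite leo_addr andbT; apply/addo_leP; split; first exact: ltW.
by move=> y; exact: addo_lt_omega_exp.
Qed.

Lemma addo_omega_exp_mulon g x n :
  x < omega^ g -> (0 < n)%N -> x + omega^ g * n%:O = omega^ g * n%:O.
Proof. by case: n => // n xg _; rewrite -add1n mulonD mulon1 addoA addo_omega_exp. Qed.

Lemma lto_mulon a N x : x < a * N%:O ->
  exists n y, [/\ (n < N)%N, y < a & x = a * n%:O + y].
Proof.
elim: N => [|N IH]; first by rewrite mulo0 ltNge le0o.
rewrite mulonS => /lto_addE[/IH[n [y [nN ya ->]]]|[y ya ->]].
  by exists n, y; split => //; exact: ltnW.
by exists N, y.
Qed.

Lemma leo_omega_exp a : a <= omega^ a.
Proof.
elim/ord_ind: a => a IH; apply: leo_sub => b ba.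
by apply: le_lt_trans (IH _ ba) _; exact: omega_exp_lt.
Qed.

Lemma omega_exp_leading a : 0%:O < a -> exists g n y,
  [/\ y < omega^ g, (0 < n)%N & a = omega^ g * n%:O + y].
Proof.
move=> a0; have [|g ag gmin] := @ord_min (fun g => a < omega^ g).
  exists (a + 1%:O); apply: le_lt_trans (leo_omega_exp a) _.
  by apply: omega_exp_lt; apply/lt_succoP.
have [a00|[g' g'g [N aN]]] := lto_omega_exp ag; first by rewrite a00 ltxx in a0.
have [n [y [_ yg aE]]] := lto_mulon aN.
exists g', n, y; split => //; case: n aE => // aE.
by case: (gmin _ g'g); rewrite aE mulo0 add0o.
Qed.

(** The last term of the Cantor normal form, found by descending through the remainders; its
    exponent controls the rank of [x]. *)
Lemma omega_exp_last x : 0%:O < x -> exists y g, x = y + omega^ g.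
Proof.
elim/ord_ind: x => x IH /omega_exp_leading[g [[|n] [y [yg // _ xE]]]].
have [y0|y0] := eqVneq y 0%:O.
  by exists (omega^ g * n%:O), g; rewrite xE y0 addo0 mulonS.
have [||z [h yE]] := IH y; last 1 first.
- by exists (omega^ g * n.+1%:O + z), h; rewrite xE yE addoA.
- rewrite xE; apply: lt_le_trans yg _; apply: le_trans (leo_addl _ _).
  by rewrite mulonS leo_addr.
- by rewrite gt0o.
Qed.

(** * Natural sums *)

(* Hessenberg's recursive definition of the natural sum. *)
Fixpoint thess (x : tree) : tree -> tree :=
  match x with
  | Node A f =>
    fix thess_x (y : tree) : tree :=
      match y with
      | Node B h => Node (fun s : A + B =>
          match s with
          | inl i => thess (f i) (Node h)
          | inr j => thess_x (h j)
          end)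
      end
  end.

Lemma tle_thess A (f : A -> tree) B (h : B -> tree) w :
  tle (thess (Node f) (Node h)) w <->
  (forall i, tlt (thess (f i) (Node h)) w) /\
  (forall j, tlt (thess (Node f) (h j)) w).
Proof.
rewrite -[thess _ _]/(Node _) tleP; split=> [H|[Hf Hh] [i|j]].
- by split => [i|j]; [exact: (H (inl i))|exact: (H (inr j))].
- exact: Hf.
- exact: Hh.
Qed.

Lemma thess_le2 u u' v v' : tle u u' -> tle v v' -> tle (thess u v) (thess u' v').
Proof.
elim: u u' v v' => A f IHf [A' f'] v v' ff'.
elim: v v' => B h IHh [B' h'] hh'; apply/tle_thess.
have [Hf Hh] := (tle_thess f' h' _).1 (tle_refl _); split => [i|j].
- by have [i' ii'] := ff' i; apply: tle_lt_trans (Hf i'); exact: IHf.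
- by have [j' jj'] := hh' j; apply: tle_lt_trans (Hh j'); exact: IHh.
Qed.

Definition hess (a b : Ord) : Ord := ord_of (thess (repr a) (repr b)).

Lemma hess_ord_of u v : hess (ord_of u) (ord_of v) = ord_of (thess u v).
Proof.
have [u1 u2] := repr_ord_of u; have [v1 v2] := repr_ord_of v.
by apply/ord_ofP; split; apply: thess_le2.
Qed.

Lemma hess_le2 a a' b b' : a <= a' -> b <= b' -> hess a b <= hess a' b'.
Proof.
rewrite -(ord_ofK a) -(ord_ofK a') -(ord_ofK b) -(ord_ofK b') !hess_ord_of.
by move=> /le_ord_of aa' /le_ord_of bb'; apply/le_ord_of/thess_le2.
Qed.

Lemma hess_leP a b c :
  hess a b <= c <->
  (forall a', a' < a -> hess a' b < c) /\ (forall b', b' < b -> hess a b' < c).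
Proof.
rewrite -(ord_ofK a) -(ord_ofK b) -(ord_ofK c).
case: (repr a) => A f; case: (repr b) => B h.
rewrite forall_lt_ord_of; last first.
  by move=> a1 a2 a12; apply: le_lt_trans; exact: hess_le2.
rewrite forall_lt_ord_of; last first.
  by move=> b1 b2 b12; apply: le_lt_trans; exact: hess_le2.
rewrite hess_ord_of le_ord_of tle_thess; split => -[Hf Hh]; split => i.
- by rewrite hess_ord_of; apply/lt_ord_of/Hf.
- by rewrite hess_ord_of; apply/lt_ord_of/Hh.
- by move: (Hf i); rewrite hess_ord_of => /lt_ord_of.
- by move: (Hh i); rewrite hess_ord_of => /lt_ord_of.
Qed.

Lemma hess_ltl a a' b : a' < a -> hess a' b < hess a b.
Proof. by have [H _] := (hess_leP a b _).1 (lexx _); exact: H. Qed.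

Lemma hess_ltr a b b' : b' < b -> hess a b' < hess a b.
Proof. by have [_ H] := (hess_leP a b _).1 (lexx _); exact: H. Qed.

(** The closure hypothesis prevents the remainders from carrying into the coefficient of [omega^ g].
    A smaller operand has a smaller coefficient or the same coefficient and a smaller remainder. *)
Lemma hess_omega_exp_le g l m x y :
  (forall x y, x < omega^ g -> y < omega^ g -> hess x y < omega^ g) ->
  x < omega^ g -> y < omega^ g ->
  hess (omega^ g * l%:O + x) (omega^ g * m%:O + y) <=
  omega^ g * (l + m)%N%:O + hess x y.
Proof.
move=> cl; move: {-2}(_ + x) (erefl (omega^ g * l%:O + x)) => a.
move: {-2}(_ + y) (erefl (omega^ g * m%:O + y)) => b.
elim/ord_ind: a b l m x y => a IHa; elim/ord_ind => b IHb l m x y bE aE xg yg.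
(* A drop in the coefficient outweighs any change of the remainders. *)
have below n z w N : z < omega^ g -> w < omega^ g -> (n < N)%N ->
    omega^ g * n%:O + hess z w < omega^ g * N%:O + hess x y.
  move=> zg wg nN; apply: lt_le_trans (leo_addl _ _).
  apply: lt_le_trans (mulon_le _ nN).
  by rewrite mulonS lto_addr2 cl.
apply/hess_leP; split => [a' a'a|b' b'b].
- move: (a'a); rewrite aE => /lto_addE[/lto_mulon[n [z [nl zg a'E]]]|[x' x'x a'E]].
    apply: le_lt_trans (IHa _ a'a b n m z y bE a'E zg yg) _.
    by apply: below => //; rewrite ltn_add2r.
  apply: le_lt_trans (IHa _ a'a b l m x' y bE a'E (lt_trans x'x xg) yg) _.
  by rewrite lto_addr2 hess_ltl.
- move: (b'b); rewrite bE => /lto_addE[/lto_mulon[n [z [nm zg b'E]]]|[y' y'y b'E]].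
    apply: le_lt_trans (IHb _ b'b l n x z b'E aE xg zg) _.
    by apply: below => //; rewrite ltn_add2l.
  apply: le_lt_trans (IHb _ b'b l m x y' b'E aE xg (lt_trans y'y yg)) _.
  by rewrite lto_addr2 hess_ltr.
Qed.

Lemma lto_omega_exp2 g x y : x < omega^ g -> y < omega^ g ->
  (x = 0%:O /\ y = 0%:O) \/
  exists2 h, h < g & exists N, x < omega^ h * N%:O /\ y < omega^ h * N%:O.
Proof.
have pos h N z : z < omega^ h * N%:O -> 0%:O < omega^ h * N%:O by apply: le_lt_trans; exact: le0o.
move=> /lto_omega_exp[->|[h1 h1g [N1 x1]]] /lto_omega_exp[->|[h2 h2g [N2 y2]]].
- by left.
- by right; exists h2 => //; exists N2; split => //; exact: pos y2.
- by right; exists h1 => //; exists N1; split => //; exact: pos x1.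
right; exists (Order.max h1 h2); first by rewrite gt_max h1g.
exists (maxn N1 N2); split.
- apply: lt_le_trans x1 _; apply: mulo_le2; last by rewrite le_nato leq_maxl.
  by apply: omega_exp_le; rewrite le_max lexx.
- apply: lt_le_trans y2 _; apply: mulo_le2; last by rewrite le_nato leq_maxr.
  by apply: omega_exp_le; rewrite le_max lexx orbT.
Qed.

(** Both operands lie below a multiple of a smaller power [omega^ h]; the induction hypothesis at
    [h] is the closure required by [hess_omega_exp_le]. *)
Lemma hess_lt_omega_exp g x y : x < omega^ g -> y < omega^ g -> hess x y < omega^ g.
Proof.
elim/ord_ind: g x y => g IH x y xg yg.
have [[-> ->]|[h hg [N [xN yN]]]] := lto_omega_exp2 xg yg.
  apply: le_lt_trans (omega_exp_gt0 g); apply/hess_leP.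
  by split => z; rewrite ltNge le0o.
have [l [x' [_ x'h ->]]] := lto_mulon xN; have [m [y' [_ y'h ->]]] := lto_mulon yN.
apply: le_lt_trans (hess_omega_exp_le l m (IH h hg) x'h y'h) _.
apply: lt_trans (omega_exp_mulon_lt (l + m).+1 hg).
by rewrite mulonS lto_addr2 IH.
Qed.

(* [s] is the union of disjoint sets indexed by [I], the [i]-th one of order type
   at most [a i]. *)
Definition splits (I : Type) (s : Ord) (a : I -> Ord) : Prop :=
  exists (phi : Ord -> I) (r : Ord -> Ord), forall d, d < s ->
    r d < a (phi d) /\ forall d', d' < d -> phi d' = phi d -> r d' < r d.

Lemma splits1 (I : Type) (i : I) s (a : I -> Ord) : s <= a i -> splits s a.
Proof. by move=> sa; exists (fun=> i), id => d ds; split => //; exact: lt_le_trans ds sa. Qed.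

Lemma splits_le (I : Type) s (a a' : I -> Ord) :
  (forall i, a i <= a' i) -> splits s a -> splits s a'.
Proof.
move=> aa' [phi [r H]]; exists phi, r => d /H[rd mono]; split => //.
exact: lt_le_trans rd _.
Qed.

(** Parts with the same index are concatenated: the ranks coming from [s'] are shifted past
    [a i]. *)
Lemma splits_add (I : Type) s s' (a a' : I -> Ord) :
  splits s a -> splits s' a' -> splits (s + s') (fun i => a i + a' i).
Proof.
move=> [phi [r H]] [phi' [r' H']].
exists (fun d => if d < s then phi d else phi' (subo d s)).
exists (fun d => if d < s then r d else a (phi' (subo d s)) + r' (subo d s)).
move=> d /lto_addE[ds|[e es' ->]].
  have [rd mono] := H d ds; rewrite ds; split; first exact: lt_le_trans (leo_addl _ _).
  by move=> d' d'd; rewrite (lt_trans d'd ds); exact: mono.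
have ns z : (s + z < s) = false by rewrite ltNge leo_addl.
have [re mono] := H' e es'; rewrite ns suboK lto_addr2; split => // d'.
move=> /lto_addE[d's|[e' e'e ->]]; last by rewrite ns suboK => E; rewrite E lto_addr2 mono.
by rewrite d's => <-; apply: lt_le_trans (leo_addl _ _); have [] := H _ d's.
Qed.

(** For [d < s], the ordinals below [d] split with the part containing [d] shortened to [r d], which
    makes the Hessenberg sum strictly smaller. *)
Lemma splits_le_hess s (a : bool -> Ord) : splits s a -> s <= hess (a true) (a false).
Proof.
move=> [phi [r H]]; elim/ord_ind: s a H => s IH a H; apply: leo_sub => d ds.
have [rd mono] := H d ds; pose a' i := if i == phi d then r d else a i.
apply: (@le_lt_trans _ _ (hess (a' true) (a' false))).
  apply: IH => // e ed; have [re mono'] := H e (lt_trans ed ds); split => //.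
  by rewrite /a'; case: eqVneq => // pe; exact: mono.
by move: rd; rewrite /a'; case: (phi d) => /= rd; [exact: hess_ltl|exact: hess_ltr].
Qed.

Lemma natural_sum_splits a b s :
  is_natural_sum a b s -> splits s (fun i : bool => if i then a else b).
Proof.
move=> [n [g [l [m [_ -> -> ->]]]]]; elim: n g l m => [|n IH] g l m.
  by exists xpredT, id => d; rewrite big_ord0 ltNge le0o.
rewrite !big_ord_recl mulonD.
have s1 : splits (omega^ (g ord0) * (l ord0)%:O)
    (fun i : bool => if i then omega^ (g ord0) * (l ord0)%:O else 0%:O).
  exact: (@splits1 _ true).
have s2 : splits (omega^ (g ord0) * (m ord0)%:O)
    (fun i : bool => if i then 0%:O else omega^ (g ord0) * (m ord0)%:O).
  exact: (@splits1 _ false).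
apply: splits_le (splits_add (splits_add s1 s2) (IH _ _ _)) => -[].
- by rewrite addo0.
- by rewrite add0o.
Qed.

Lemma big_omega_exp_lt n (g : 'I_n -> Ord) (l : 'I_n -> nat) h :
  (forall j, g j < h) ->
  \big[addo/0%:O]_(j < n) (omega^ (g j) * (l j)%:O) < omega^ h.
Proof.
move=> gh; apply: (big_ind (fun z => z < omega^ h)).
- exact: omega_exp_gt0.
- exact: addo_lt_omega_exp.
- by move=> j _; exact: omega_exp_mulon_lt.
Qed.

(** Splitting gives one inequality; for the other, the leading power is peeled off, the tails being
    below it. The natural sum thus inherits strict monotonicity from Hessenberg's recursion. *)
Lemma is_natural_sumE a b s : is_natural_sum a b s -> s = hess a b.
Proof.
move=> abs; apply/le_anti; rewrite (splits_le_hess (natural_sum_splits abs)) /=.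
case: abs => n [g [l [m [gmono -> -> ->]]]].
elim: n g l m gmono => [|n IH] g l m gmono.
  by rewrite !big_ord0; apply/hess_leP; split => z; rewrite ltNge le0o.
rewrite !big_ord_recl.
have glt j : g (lift ord0 j) < g ord0 by exact: gmono.
apply: le_trans (hess_omega_exp_le _ _ _ _ _) _.
- exact: hess_lt_omega_exp.
- exact: big_omega_exp_lt.
- exact: big_omega_exp_lt.
by rewrite leo_addr2; apply: IH => i j ij; apply: gmono; rewrite ltnS.
Qed.

Definition ord_cons (T : Type) n (z : T) (f : 'I_n -> T) (i : 'I_n.+1) : T :=
  oapp f z (unlift ord0 i).

Lemma ord_cons0 T n (z : T) (f : 'I_n -> T) : ord_cons z f ord0 = z.
Proof. by rewrite /ord_cons unlift_none. Qed.

Lemma ord_consS T n (z : T) (f : 'I_n -> T) i : ord_cons z f (lift ord0 i) = f i.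
Proof. by rewrite /ord_cons liftK. Qed.

(** Both operands are divided by the leading power of the larger one, allowing a zero quotient, and
    the induction continues with the remainders. *)
Lemma is_natural_sum_exists a b : exists s, is_natural_sum a b s.
Proof.
(* The bound on [omega^ (g j)] is kept for the induction: it places the exponents of the remainders
   below the leading one. *)
suff [n [g [l [m [gmono aE bE _]]]]] : exists n (g : 'I_n -> Ord) (l m : 'I_n -> nat),
    [/\ {homo g : i j / (i < j)%N >-> j < i},
        a = \big[addo/0%:O]_(j < n) (omega^ (g j) * (l j)%:O),
        b = \big[addo/0%:O]_(j < n) (omega^ (g j) * (m j)%:O) &
        forall j, omega^ (g j) <= Order.max a b].
  by exists (\big[addo/0%:O]_(j < n) (omega^ (g j) * (l j + m j)%N%:O)), n, g, l, m.
have := lexx (Order.max a b); move: {2}(Order.max a b) => M.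
elim/ord_ind: M a b => M IH a b; rewrite ge_max => /andP[aM bM].
have [ab0|ab0] := eqVneq (Order.max a b) 0%:O.
  exists 0, (fun=> 0%:O), (fun=> 0), (fun=> 0); split; rewrite ?big_ord0; try by case.
  - by apply/le_anti; rewrite le0o andbT -ab0 le_max lexx.
  - by apply/le_anti; rewrite le0o andbT -ab0 le_max lexx orbT.
have [|g0 [N [z [zg N0 abE]]]] := @omega_exp_leading (Order.max a b); first by rewrite gt0o.
have gab : omega^ g0 <= Order.max a b.
  rewrite abE; apply: le_trans (leo_addl _ _).
  by rewrite -{1}(mulon1 (omega^ g0)) mulon_le.
have abN : Order.max a b < omega^ g0 * N.+1%:O by rewrite abE mulonS lto_addr2.
have [l0 [x [_ xg aE]]] :
    exists l0 x, [/\ (l0 < N.+1)%N, x < omega^ g0 & a = omega^ g0 * l0%:O + x].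
  by apply: lto_mulon; apply: le_lt_trans abN; rewrite le_max lexx.
have [m0 [y [_ yg bE]]] :
    exists m0 y, [/\ (m0 < N.+1)%N, y < omega^ g0 & b = omega^ g0 * m0%:O + y].
  by apply: lto_mulon; apply: le_lt_trans abN; rewrite le_max lexx orbT.
have xyg : Order.max x y < omega^ g0 by rewrite gt_max xg.
have [||n [g [l [m [gmono xE yE gmax]]]]] := IH (Order.max x y) _ x y; last 1 first.
- have gg0 j : g j < g0 by apply: omega_exp_lt_inv; exact: le_lt_trans (gmax j) xyg.
  exists n.+1, (ord_cons g0 g), (ord_cons l0 l), (ord_cons m0 m); split.
  + move=> i j; case: (unliftP ord0 j) => [j' ->|-> //]; rewrite ord_consS.
    case: (unliftP ord0 i) => [i' ->|->]; last by rewrite ord_cons0.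
    by rewrite ord_consS => /gmono.
  + rewrite big_ord_recl !ord_cons0 aE {1}xE; congr addo.
    by apply: eq_bigr => j _; rewrite !ord_consS.
  + rewrite big_ord_recl !ord_cons0 bE {1}yE; congr addo.
    by apply: eq_bigr => j _; rewrite !ord_consS.
  + move=> j; case: (unliftP ord0 j) => [j' ->|->]; last by rewrite ord_cons0.
    by rewrite ord_consS; apply: le_trans gab; exact/ltW/(le_lt_trans (gmax _)).
- by apply: lt_le_trans xyg (le_trans gab _); rewrite ge_max aM.
- exact: lexx.
Qed.

Lemma natural_sumP a b : is_natural_sum a b (natural_sum a b).
Proof.
rewrite /natural_sum; case: xgetP => // none.
by have [s /none] := is_natural_sum_exists a b.
Qed.

Lemma natural_sumE a b : natural_sum a b = hess a b.
Proof. exact/is_natural_sumE/natural_sumP. Qed.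

Lemma big_natural_sum_le k (a b : 'I_k -> Ord) : (forall i, a i <= b i) ->
  \big[natural_sum/0%:O]_(i < k) a i <= \big[natural_sum/0%:O]_(i < k) b i.
Proof.
elim: k a b => [|k IH] a b ab; first by rewrite !big_ord0.
by rewrite !big_ord_recl !natural_sumE; apply: hess_le2 => //; exact: IH.
Qed.

Lemma big_natural_sum_lt k (a b : 'I_k -> Ord) i0 :
  (forall i, a i <= b i) -> a i0 < b i0 ->
  \big[natural_sum/0%:O]_(i < k) a i < \big[natural_sum/0%:O]_(i < k) b i.
Proof.
elim: k a b i0 => [|k IH] a b i0 ab; first by case: i0.
rewrite !big_ord_recl !natural_sumE; case: (unliftP ord0 i0) => [j ->|->] abi.
  apply: (@le_lt_trans _ _ (hess (b ord0) (\big[natural_sum/0%:O]_(i < k) a (lift ord0 i)))).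
    by apply: hess_le2.
  exact/hess_ltr/(IH _ _ j).
by apply: lt_le_trans (hess_ltl _ abi) _; apply: hess_le2 => //; exact: big_natural_sum_le.
Qed.

(** Iterates the splitting into two parts: an element of the second part is passed, through its rank
    [r d], to the splitting of the remaining sum. *)
Lemma big_natural_sum_splits k (a : 'I_k.+1 -> Ord) :
  splits (\big[natural_sum/0%:O]_(i < k.+1) a i) a.
Proof.
elim: k a => [|k IH] a; rewrite big_ord_recl; set s := \big[_/_]_(i < _) _;
  have [phi [r H]] := natural_sum_splits (natural_sumP (a ord0) s).
  exists (fun=> ord0), r => d ds; have [rd mono] := H d ds.
  have phiT e : e < natural_sum (a ord0) s -> phi e.
    by move=> /H[+ _]; case: (phi e) => //; rewrite /s big_ord0 ltNge le0o.
  split; first by move: rd; rewrite phiT.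
  by move=> d' d'd _; apply: mono => //; rewrite !phiT //; exact: lt_trans d'd ds.
have [phi' [r' H']] := IH (fun i => a (lift ord0 i)).
exists (fun d => if phi d then ord0 else lift ord0 (phi' (r d))).
exists (fun d => if phi d then r d else r' (r d)) => d ds.
have [rd mono] := H d ds; case: ifPn => pd.
  split; first by move: rd; rewrite pd.
  by move=> d' d'd; case: ifP => // pd' _; apply: mono; rewrite ?pd' ?pd.
have rs : r d < s by move: rd; rewrite (negbTE pd).
have [r'd mono'] := H' _ rs; split => // d' d'd; case: ifP => // pd' /lift_inj E.
by apply: mono' => //; apply: mono; rewrite // pd' (negbTE pd).
Qed.

(** * Embeddings of ordinals *)

(** The third clause is continuity of the inverse on the image, expressed with neighbourhoods in the
    whole of [T]. *)
Definition embedding (S T : topologicalType) (f : S -> T) : Prop :=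
  [/\ injective f, continuous f &
      forall (x : S) (A : set S), nbhs x A -> exists2 B, nbhs (f x) B & f @^-1` B `<=` A].

Lemma embedding_comp (S T U : topologicalType) (f : S -> T) (h : T -> U) :
  embedding f -> embedding h -> embedding (h \o f).
Proof.
move=> [fi fc fo] [hi hc ho]; split.
- exact: inj_comp.
- by move=> x; apply: continuous_comp; [exact: fc|exact: hc].
- move=> x A /fo[B /ho[C Cx CB] BA]; exists C => // y Cy.
  exact/BA/CB.
Qed.

Lemma homeomorphic_subsetP (S T : topologicalType) (P : set T) :
  (exists X : set T, X `<=` P /\ homeomorphic (set_type X) S) <->
  exists2 f : S -> T, embedding f & forall x : S, P (f x).
Proof.
split=> [[X [XP [f [h [fK hK fc hc]]]]]|[f [fi fc fo] fP]].
  exists (set_val \o h) => [|x]; last by apply: XP; exact: set_valP.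
  split.
  - by apply: inj_comp (can_inj hK); exact: val_inj.
  - by move=> x; apply: continuous_comp; [exact: hc|exact: initial_continuous].
  - move=> x A xA; have : nbhs (h x) (f @^-1` A) by apply: fc; rewrite hK.
    move=> [_ [[B oB <-] Bhx BA]]; exists B; first exact: open_nbhs_nbhs.
    by move=> y By; rewrite -(hK y); apply: BA.
exists (range f); split; first by move=> _ [x _ <-].
have rangeP (y : set_type (range f)) : exists x : S, f x = set_val y.
  by have [x _] := set_valP y; exists x.
pose F y := projT1 (cid (rangeP y)).
have FE y : f (F y) = set_val y by rewrite /F; case: cid.
have fr (x : S) : f x \in range f by apply/mem_set; exists x.
exists F, (fun x => SigSub (fr x)); split.
- by move=> y; apply: val_inj => /=; exact: FE.
- by move=> x; apply: fi; rewrite FE.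
- move=> y A /fo[B]; rewrite FE => By BA.
  have sub : set_val @^-1` B `<=` F @^-1` A by move=> z Bz; apply: BA; rewrite /= FE.
  exact: filterS sub (@initial_continuous _ _ (set_val : set_type (range f) -> T) y _ By).
- apply: (@continuous_comp_initial _ _ _ (set_val : set_type (range f) -> T)); exact: fc.
Qed.

(** The point [x] has a successor or is the last point, so the segment up to [x] is open and only
    points below [x] have to be tested. *)
Lemma nbhs_segmentP b (x : segment b) (A : set (segment b)) :
  nbhs x A <->
  A x /\ (0%:O < val x -> exists2 xi, xi < val x &
    forall z, xi < val z -> val z < val x -> A z).
Proof.
rewrite {1}itv_nbhsE; split=> [[i [oi xi] iA]|[Ax xA]].
  split; first by apply: iA.
  case: i oi xi iA => l r oi; rewrite itv_boundlr => /andP[lx xr] iA x0.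
  have zr z : val z < val x -> (BRight z <= r)%O.
    move=> zx; apply: le_trans xr; exact: ltW.
  case: l oi lx iA => [[] t oi|[] oi] lx iA //.
  - exists (val t) => // z tz zx; apply: iA.
    by rewrite /= itv_boundlr zr // andbT.
  - by exists 0%:O => // z _ zx; apply: iA; rewrite /= itv_boundlr zr.
have xnbhs (V : set (segment b)) : open V -> V x -> nbhs x V.
  by move=> *; exact: open_nbhs_nbhs.
have [V [Vx VP]] : exists V : set (segment b), nbhs x V /\ forall z, V z -> z <= x.
  have [xb|bx] := ltP (val x + 1%:O) b.
    exists `]-oo, (exist (fun u : Ord => u < b) _ xb : segment b)[%classic; split.
      apply: xnbhs; first exact: lray_open.
      by rewrite /= in_itv /=; apply/lt_succoP.
    by move=> z; rewrite /= in_itv /= => /lt_succoP.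
  exists setT; split; first exact: filterT.
  move=> z _; have /= := valP z => zb; apply/lt_succoP.
  exact: lt_le_trans zb bx.
have [U [Ux UA]] : exists U : set (segment b), nbhs x U /\ forall z, U z -> z < x -> A z.
  have [x0|x0] := eqVneq (val x) 0%:O.
    exists setT; split=> [|z _]; first exact: filterT.
    by rewrite ltEsub/= x0 ltNge le0o.
  have [|xi xix xiA] := xA _; first by rewrite gt0o.
  have xib : xi < b by exact: lt_trans xix (valP x).
  exists `](exist (fun u : Ord => u < b) _ xib : segment b), +oo[%classic; split.
    apply: xnbhs; first exact: rray_open.
    by rewrite /= in_itv /= andbT.
  by move=> z; rewrite /= in_itv /= andbT => xiz zx; exact: xiA.
rewrite -itv_nbhsE; apply: filterS _ (filterI Ux Vx) => z [Uz /VP].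
by rewrite le_eqVlt => /predU1P[->//|]; exact: UA.
Qed.

(** By [nbhs_segmentP], continuity and openness onto the image become one-sided conditions. The form
    admits maps that do not preserve the order, such as the exchange of two clopen parts. *)
Lemma segment_embedding b b' (f : segment b -> segment b') :
  injective f ->
  (forall x, 0%:O < val x -> exists2 xi, xi < val x &
    forall z, xi < val z -> val z < val x -> val (f z) < val (f x)) ->
  (forall x eta, 0%:O < val x -> eta < val (f x) -> exists2 xi, xi < val x &
    forall z, xi < val z -> val z < val x -> eta < val (f z)) ->
  (forall x xi, xi < val x -> exists2 eta, eta < val (f x) \/ val (f x) = 0%:O &
    forall z, eta < val (f z) -> val (f z) < val (f x) -> xi < val z /\ val z < val x) ->
  (forall x, val x = 0%:O -> 0%:O < val (f x) -> exists2 eta, eta < val (f x) &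
    forall z, eta < val (f z) -> ~ val (f z) < val (f x)) ->
  embedding f.
Proof.
move=> finj flt fgt fopen fopen0; split => //.
- move=> x A /nbhs_segmentP[Ax xA]; apply/nbhs_segmentP; split => // x0.
  have [xi1 xi1x H1] := flt x x0.
  have [fx0|fx0] := eqVneq (val (f x)) 0%:O.
    by exists xi1 => // z xi1z zx; move: (H1 z xi1z zx); rewrite fx0 ltNge le0o.
  have [|eta etax H] := xA _; first by rewrite gt0o.
  have [xi2 xi2x H2] := fgt x eta x0 etax.
  exists (Order.max xi1 xi2) => [|z]; first by rewrite gt_max xi1x.
  by rewrite gt_max => /andP[xi1z xi2z] zx; apply: H; [exact: H2|exact: H1].
- move=> x A /nbhs_segmentP[Ax xA].
  have [x0|x0] := eqVneq (val x) 0%:O.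
    (* Points outside the image belong to this set vacuously, so only image points need checking. *)
    exists [set w | f x = w \/ forall z, f z = w -> A z]; last first.
      by move=> z /= [/finj <-//|]; exact.
    apply/nbhs_segmentP; split => [|fx0]; first by left.
    have [eta etax H] := fopen0 x x0 fx0.
    exists eta => // w etaw wx; right => z zw.
    by case: (H z); rewrite zw.
  have [|xi xix H] := xA _; first by rewrite gt0o.
  have [eta etax K] := fopen x xi xix.
  exists [set w | f x = w \/ forall z, f z = w -> A z]; last first.
    by move=> z /= [/finj <-//|]; exact.
  apply/nbhs_segmentP; split => [|fx0]; first by left.
  exists eta; first by case: etax => // E; rewrite E ltxx in fx0.
  move=> w etaw wx; right => z zw.
  have [|| xiz zx] := K z; rewrite ?zw //; exact: H.
Qed.

Lemma exists_segment_map b b' (F : Ord -> Ord) : (forall u, u < b -> F u < b') ->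
  exists f : segment b -> segment b', forall x, val (f x) = F (val x).
Proof.
move=> Fb; exists (fun x => exist (fun u : Ord => u < b') _ (Fb _ (valP x))).
by [].
Qed.

Lemma monotone_embedding b b' (F : Ord -> Ord) (f : segment b -> segment b') :
  (forall x, val (f x) = F (val x)) ->
  (forall u v : Ord, u < v -> v < b -> F u < F v) ->
  (forall v eta : Ord, 0%:O < v -> v < b -> eta < F v -> exists2 u, u < v &
     forall w, u < w -> w < v -> eta < F w) ->
  embedding f.
Proof.
move=> fE Fmono Fcont.
have fmono z x : val z < val x -> val (f z) < val (f x).
  by move=> zx; rewrite !fE Fmono //; exact: (valP x).
have fmonoE z x : (val (f z) < val (f x)) = (val z < val x).
  apply/idP/idP => [|/fmono//]; apply: contraTT; rewrite -!leNgt le_eqVlt.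
  by move=> /predU1P[/val_inj ->//|/fmono/ltW].
apply: segment_embedding.
- move=> x y xy; apply: val_inj; apply/le_anti.
  by rewrite !leNgt -!fmonoE xy ltxx.
- by move=> x x0; exists 0%:O => // z _; exact: fmono.
- move=> x eta x0; rewrite fE => /Fcont[//||u ux H]; first exact: (valP x).
  by exists u => // z uz zx; rewrite fE; exact: H.
- move=> x xi xix; have xib : xi < b by exact: lt_trans xix (valP x).
  exists (F xi); first by left; rewrite fE; apply: Fmono => //; exact: (valP x).
  move=> z; pose t : segment b := exist (fun u : Ord => u < b) _ xib.
  by rewrite -[xi]/(val t) -fE !fmonoE.
- by move=> x x0 fx0; exists 0%:O => // z _; rewrite fmonoE x0 ltNge le0o.
Qed.

(* Exchanging the two clopen parts [0, d] and ]d, d + c] of the source. *)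
Lemma swap_embedding c d : 0%:O < d -> (c + 1%:O) + d = d -> c < d ->
  (* NONE *)
  exists f : segment (d + 1%:O + c) -> segment (d + 1%:O), embedding f.
Proof.
(* The part [[0, d]] goes onto [[p, d]], as [p + d = d], and the last [c] points go to the
   beginning. With [p = c + 1] rather than [c], the image of 0 is a successor, hence isolated as 0
   is. *)
move=> d0 cd ltcd; pose M := d + 1%:O; pose p := c + 1%:O.
pose F u := if u < M then p + u else subo u M.
have F1 u : u < M -> F u = p + u by rewrite /F => ->.
have F2 v : F (M + v) = v by rewrite /F suboK ltNge leo_addl.
have [f fE] : exists f : segment (M + c) -> segment M, forall x, val (f x) = F (val x).
  apply: exists_segment_map => u /lto_addE[uM|[v vc ->]].
    by rewrite F1 //; apply/lt_succoP; rewrite -[leRHS]cd leo_addr2; apply/lt_succoP.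
  by rewrite F2; apply/lt_succoP/ltW; exact: lt_trans vc ltcd.
have dec (x : segment (M + c)) :
    (val x < M /\ val (f x) = p + val x) \/
    exists v, [/\ v < c, val x = M + v & val (f x) = v].
  have /lto_addE[xM|[v vc xE]] := valP x; [left|right].
    by rewrite fE F1.
  by exists v; rewrite fE xE F2.
have cp : c < p by apply/lt_succoP.
have disj v u : v < c -> v <> p + u.
  by move=> vc vE; move: (lt_trans vc cp); rewrite vE ltNge leo_addl.
exists f; apply: segment_embedding.
- move=> x y xy; apply: val_inj.
  have [[xM xE]|[v [vc xE xv]]] := dec x; have [[yM yE]|[w [wc yE yw]]] := dec y.
  + by apply: (@addo_inj p); rewrite -xE -yE xy.
  + by case: (@disj w (val x)); rewrite // -xE xy.
  + by case: (@disj v (val y)); rewrite // -yE -xy.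
  + by rewrite xE yE -xv -yw xy.
- move=> x x0; have [[xM xE]|[v [vc xE xv]]] := dec x.
    exists 0%:O => // z _ zx; have zM := lt_trans zx xM.
    by rewrite xE fE F1 // lto_addr2.
  exists d; first by rewrite xE -addoA lto_addl // (lt_le_trans _ (leo_addl _ _)) // lt_nato.
  move=> z dz; have [[/lt_succoP]|[w [wc zE zw]]] := dec z; first by rewrite leNgt dz.
  by rewrite zE xE zw xv lto_addr2.
- move=> x eta x0; have [[xM xE]|[v [vc xE xv]]] := dec x.
    rewrite xE => /lto_addE[etap|[e ex ->]].
      exists 0%:O => // z _ zx; rewrite fE F1 ?(lt_trans zx) //.
      exact: lt_le_trans (leo_addl _ _).
    exists e => // z ez zx; rewrite fE F1 ?(lt_trans zx) //.
    by rewrite lto_addr2.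
  rewrite xv => etav; exists (M + eta); first by rewrite xE lto_addr2.
  move=> z etaz; have [[zM _]|[w [wc zE zw]]] := dec z.
    by move: (lt_trans etaz zM); rewrite ltNge leo_addl.
  by rewrite zw -(lto_addr2 M eta w) -zE.
- move=> x xi xix; have [[xM xE]|[v [vc xE xv]]] := dec x.
    exists (p + xi); first by left; rewrite xE lto_addr2.
    move=> z; have [[zM ->]|[w [wc _ ->]]] := dec z; first by rewrite xE !lto_addr2.
    by move=> /lt_trans/(_ (lt_trans wc cp)); rewrite ltNge leo_addl.
  have [xiM|/leo_exists_sub[e xiE]] := ltP xi M.
    exists 0%:O; first by rewrite gt0o; have [->|] := eqVneq (val (f x)) 0%:O; [right|left].
    move=> z _; have [[zM ->]|[w [wc zE ->]]] := dec z.
      rewrite xv => /lt_trans/(_ vc)/lt_trans/(_ cp).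
      by rewrite ltNge leo_addl.
    rewrite xv zE xE lto_addr2; split => //.
    exact: lt_le_trans xiM (leo_addl _ _).
  exists e; first by left; rewrite xv -(lto_addr2 M e v) -xiE -xE.
  move=> z; have [[zM ->]|[w [wc zE ->]]] := dec z; last by rewrite xv zE xE xiE !lto_addr2.
  rewrite xv => _ /lt_trans/(_ vc)/lt_trans/(_ cp).
  by rewrite ltNge leo_addl.
- move=> x x0; have [[xM ->]|[v [vc xE _]]] := dec x; last first.
    have := lt_le_trans d0 (le_trans (leo_addl d 1%:O) (leo_addl M v)).
    by rewrite -xE x0 ltxx.
  rewrite x0 addo0 => _; exists c => // z cz /lt_succoP.
  by rewrite leNgt cz.
Qed.

Lemma top_arrowP k b (beta : 'I_k -> Ord) :
  top_arrow b beta <-> forall col : segment b -> 'I_k,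
    exists i (f : segment (beta i) -> segment b), embedding f /\ forall x, col (f x) = i.
Proof.
split=> H col; have [i Hi] := H col; exists i.
  have [f ef fi] := (homeomorphic_subsetP (segment (beta i)) (col @^-1` [set i])).1 Hi.
  by exists f.
apply: (homeomorphic_subsetP (segment (beta i)) (col @^-1` [set i])).2.
by have [f [ef fi]] := Hi; exists f.
Qed.

Lemma top_arrow_embedding k b b' (beta : 'I_k -> Ord) (f : segment b -> segment b') :
  embedding f -> top_arrow b beta -> top_arrow b' beta.
Proof.
move=> ef /top_arrowP bk; apply/top_arrowP => col.
have [i [h [eh hi]]] := bk (col \o f); exists i, (f \o h); split => //.
exact: embedding_comp.
Qed.

(** * Cantor-Bendixson ranks *)

(* [accum X d x]: the Cantor-Bendixson rank of [x] in the subspace [X `|` [set x]]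
   is at least [d]. *)
Fixpoint taccum (X : set Ord) (t : tree) (x : Ord) {struct t} : Prop :=
  match t with
  | Node A f => forall i : A, 0%:O < x /\ forall xi, xi < x ->
      exists y, [/\ X y, xi < y, y < x & taccum X (f i) y]
  end.

Lemma taccum_le X s t x : tle s t -> taccum X t x -> taccum X s x.
Proof.
elim: s t x => A f IH [B h] x fh H i; have [j ij] := fh i.
have [x0 Hx] := H j; split => // xi /Hx[y [Xy xiy yx Hy]].
by exists y; split => //; exact: IH Hy.
Qed.

Definition accum (X : set Ord) (d x : Ord) : Prop := taccum X (repr d) x.

Lemma accum_le X d d' x : d' <= d -> accum X d x -> accum X d' x.
Proof. by move=> /asboolP; exact: taccum_le. Qed.

Lemma accum_ord_of X t x : accum X (ord_of t) x <-> taccum X t x.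
Proof. by have [t1 t2] := repr_ord_of t; split; exact: taccum_le. Qed.

Lemma accumP X d x : accum X d x <-> forall d', d' < d -> 0%:O < x /\
  forall xi, xi < x -> exists y, [/\ X y, xi < y, y < x & accum X d' y].
Proof.
rewrite -(ord_ofK d); case: (repr d) => A f; rewrite forall_lt_ord_of; last first.
  move=> d1 d2 d12 [x0 H]; split => // xi /H[y [Xy xiy yx Hy]].
  by exists y; split => //; exact: accum_le Hy.
rewrite accum_ord_of; split => H i; have [x0 Hx] := H i; split => // xi /Hx[y [Xy xiy yx]].
  by exists y; split => //; exact/accum_ord_of.
by move/accum_ord_of; exists y.
Qed.

Lemma accum_leo X d x : accum X d x -> d <= x.
Proof.
elim/ord_ind: d x => d IH x /accumP H; apply: leo_sub => d' d'd.
have [x0 /(_ _ x0)[y [_ _ yx Hy]]] := H _ d'd.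
exact: le_lt_trans (IH _ d'd _ Hy) yx.
Qed.

(** The greatest [d] with [accum X d x], where [x] may lie outside [X]. It exists because such [d]
    are at most [x], so the default is never taken. *)
Definition cbrank (X : set Ord) (x : Ord) : Ord :=
  xget 0%:O [set d | accum X d x /\ ~ accum X (d + 1%:O) x].

Lemma cbrankP X x : accum X (cbrank X x) x /\ ~ accum X (cbrank X x + 1%:O) x.
Proof.
rewrite /cbrank; case: xgetP => // none.
have [|d Hd dmin] := @ord_min (fun d => ~ accum X (d + 1%:O) x).
  by exists x => /accum_leo; rewrite leNgt => /negP; apply; apply/lt_succoP.
case: (none d); split => //; apply/accumP => d' /[dup] d'd /dmin/contrapT/accumP.
by apply; apply/lt_succoP.
Qed.

Lemma accum_cbrank X d x : accum X d x <-> d <= cbrank X x.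
Proof.
have [H1 H2] := cbrankP X x; split=> [H|dx]; last exact: accum_le H1.
by rewrite leNgt; apply/negP => /succo_leP/accum_le/(_ H).
Qed.

(** If points of [X] of rank at least that of [x] accumulated at [x], the rank of [x] would be
    larger. A nearby point of larger rank, in [X] or not, would be a limit of such points. *)
Lemma cbrank_nbhs X x : 0%:O < x -> exists2 xi, xi < x & forall y, xi < y -> y < x ->
  cbrank X y <= cbrank X x /\ (X y -> cbrank X y < cbrank X x).
Proof.
move=> x0; have [_] := cbrankP X x.
have [[xi xix H] _|/forall2NP H []] := pselect (exists2 xi, xi < x &
    forall y, xi < y -> y < x -> X y -> ~ accum X (cbrank X x) y); last first.
  apply/accumP => d /lt_succoP dx; split => // xi xix.
  have [/(_ xix)//|/existsNP[y /not_implyP[xiy /not_implyP[yx /not_implyP[Xy /contrapT Hy]]]]] := H xi.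
  by exists y; split => //; exact: accum_le Hy.
have lt_rank y : xi < y -> y < x -> X y -> cbrank X y < cbrank X x.
  by move=> xiy yx /(H y xiy yx) nacc; rewrite ltNge; apply/negP => /accum_cbrank.
exists xi => // y xiy yx; split; last exact: lt_rank.
rewrite leNgt; apply/negP => lt_xy.
have [_ /accumP/(_ _ lt_xy)[y0 /(_ _ xiy)[z [Xz xiz zy Hz]]]] := (cbrankP X y, (cbrankP X y).1).
by apply: (H z) => //; exact: lt_trans zy yx.
Qed.

Lemma cbrank_nbhs_all k (C : 'I_k -> set Ord) x : 0%:O < x ->
  exists2 xi, xi < x & forall y, xi < y -> y < x -> forall i,
    cbrank (C i) y <= cbrank (C i) x /\ (C i y -> cbrank (C i) y < cbrank (C i) x).
Proof.
move=> x0; have H i : exists xi, xi < x /\ forall y, xi < y -> y < x ->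
    cbrank (C i) y <= cbrank (C i) x /\ (C i y -> cbrank (C i) y < cbrank (C i) x).
  by have [xi] := cbrank_nbhs (C i) x0; exists xi.
have [xi Hxi] := choice H.
exists (\big[Order.max/0%:O]_(i < k) xi i).
  by apply: (big_ind (fun z => z < x)) => // [u v ux vx|i _]; [rewrite gt_max ux|have [] := Hxi i].
move=> y xiy yx i; have [_] := Hxi i; apply => //.
exact: le_lt_trans (le_bigmax_cond _ _ _) xiy.
Qed.

Lemma omega_exp_accum g h u xi : h < g -> xi < u + omega^ g ->
  exists v, xi < v + omega^ h /\ v + omega^ h < u + omega^ g.
Proof.
move=> hg /lto_addE[xiu|[e eg ->]].
  exists u; rewrite lto_addr2 omega_exp_lt //; split => //.
  exact: lt_le_trans (leo_addl _ _).
exists (u + e); rewrite lto_addl ?omega_exp_gt0 // -addoA lto_addr2.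
by rewrite addo_lt_omega_exp // omega_exp_lt.
Qed.

(* By induction on [g]: all the ranks are attained near [x], and passing to a point
   of [C i] near [x] decreases the [i]-th rank and does not increase the others. *)
Lemma cbrank_cover k (C : 'I_k -> set Ord) b g u :
  (forall y, y < b -> exists i, C i y) -> u + omega^ g <= b ->
  g <= \big[natural_sum/0%:O]_(i < k) cbrank (C i) (u + omega^ g).
Proof.
move=> cover; elim/ord_ind: g u => g IH u ub; apply: leo_sub => h hg.
have x0 : 0%:O < u + omega^ g by exact: lt_le_trans (omega_exp_gt0 g) (leo_addr _ _).
have [xi xix H] := cbrank_nbhs_all C x0.
have [v [xiv vx]] := omega_exp_accum hg xix.
have vb := lt_le_trans vx ub; have [i Ci] := cover _ vb.
apply: le_lt_trans (IH h hg v (ltW vb)) _.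
apply: (big_natural_sum_lt (i0 := i)) => [j|]; first by have [] := H _ xiv vx j.
by have [_] := H _ xiv vx i; apply.
Qed.

Lemma omega_exp_below g u y : u < y -> y < u + omega^ g ->
  exists v h, h < g /\ y = v + omega^ h.
Proof.
move=> uy /lto_addE[/(lt_trans uy)|[e eg yE]]; first by rewrite ltxx.
have e0 : 0%:O < e by rewrite gt0o; apply: contraTneq uy => e0; rewrite yE e0 addo0 ltxx.
have [e' [h eE]] := omega_exp_last e0.
exists (u + e'), h; split; last by rewrite -addoA -eE.
by apply: omega_exp_lt_inv; apply: le_lt_trans eg; rewrite eE leo_addr.
Qed.

(** Points strictly between [u] and [u + omega^ g] end in a smaller power, so by induction their
    ranks are below [g]. *)
Lemma cbrank_setT_le g u : cbrank setT (u + omega^ g) <= g.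
Proof.
elim/ord_ind: g u => g IH u; rewrite leNgt; apply/negP => lt_g.
have [/accumP/(_ _ lt_g)[_ /(_ u)]] := cbrankP setT (u + omega^ g).
case; first by rewrite lto_addl ?omega_exp_gt0.
move=> y [_ uy /(omega_exp_below uy)[v [h [hg ->]]]] /accum_cbrank.
by move=> /le_trans/(_ (IH h hg v)); rewrite leNgt hg.
Qed.

(* With left-open intervals, maps on ]0, b] and ]0, c] concatenate to one on ]0, b + c]. *)
Definition normal_on (b : Ord) (F : Ord -> Ord) : Prop :=
  (forall u v : Ord, 0%:O < u -> u < v -> v <= b -> F u < F v) /\
  (forall v eta : Ord, 0%:O < v -> v <= b -> eta < F v -> exists2 u, u < v &
     forall w, u < w -> w < v -> eta < F w).

Lemma normal_on_le b b' F : b' <= b -> normal_on b F -> normal_on b' F.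
Proof.
move=> b'b [Fm Fc]; split=> [u v u0 uv vb|v eta v0 vb].
  by apply: Fm => //; exact: le_trans b'b.
by apply: Fc => //; exact: le_trans b'b.
Qed.

Lemma normal_on0 F : normal_on 0%:O F.
Proof.
split=> [u v _ uv|v eta v0]; last by rewrite leNgt v0.
by rewrite leNgt (le_lt_trans (le0o u) uv).
Qed.

Definition cat_fun (b : Ord) (F G : Ord -> Ord) (u : Ord) : Ord :=
  if u <= b then F u else G (subo u b).

Lemma cat_funl b F G u : u <= b -> cat_fun b F G u = F u.
Proof. by rewrite /cat_fun => ->. Qed.

Lemma cat_funr b F G u : 0%:O < u -> cat_fun b F G (b + u) = G u.
Proof. by move=> u0; rewrite /cat_fun suboK leNgt lto_addl. Qed.

Lemma cat_fun_cases b c u : 0%:O < u -> u <= b + c ->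
  u <= b \/ exists v, [/\ 0%:O < v, v <= c & u = b + v].
Proof.
move=> u0 ubc; have [ub|bu] := leP u b; [by left|right].
have [v uE] := leo_exists_sub (ltW bu); exists v; split => //.
- by rewrite gt0o; apply: contraTneq bu => v0; rewrite uE v0 addo0 ltxx.
- by rewrite -(leo_addr2 b) -uE.
Qed.

Lemma normal_on_cat b c F G : normal_on b F -> normal_on c G ->
  (forall u v, 0%:O < u -> u <= b -> 0%:O < v -> v <= c -> F u < G v) ->
  normal_on (b + c) (cat_fun b F G).
Proof.
move=> [Fm Fc] [Gm Gc] FG; split=> [u v u0 uv vbc|v eta v0 vbc].
  have [vb|[v' [v'0 v'c vE]]] := cat_fun_cases (lt_trans u0 uv) vbc.
    by rewrite !cat_funl //; [exact: Fm|exact: ltW (lt_le_trans uv vb)].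
  rewrite vE cat_funr //.
  have [ub|[u' [u'0 u'c uE]]] := cat_fun_cases u0 (ltW (lt_le_trans uv vbc)).
    by rewrite cat_funl //; exact: FG.
  by rewrite uE cat_funr //; apply: Gm => //; rewrite -(lto_addr2 b) -uE -vE.
have [vb|[v' [v'0 v'c vE]]] := cat_fun_cases v0 vbc.
  rewrite cat_funl // => /(Fc _ _ v0 vb)[u uv H]; exists u => // w uw wv.
  by rewrite cat_funl ?H // ltW // (lt_le_trans wv).
rewrite {1}vE cat_funr // => /(Gc _ _ v'0 v'c)[u uv' H].
exists (b + u); first by rewrite vE lto_addr2.
move=> w uw wv.
have [d wE] := leo_exists_sub (ltW (le_lt_trans (leo_addl b u) uw)).
have ud : u < d by rewrite -(lto_addr2 b) -wE.
rewrite wE cat_funr ?(le_lt_trans (le0o u)) //; apply: H => //.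
by rewrite -(lto_addr2 b) -wE -vE.
Qed.

(** * Closed copies of powers of omega at accumulation points *)

Lemma countable_enum (x : Ord) : countable [set y | y < x] -> 0%:O < x ->
  exists q : nat -> Ord, (forall n, q n < x) /\ forall y : Ord, y < x -> exists n, q n = y.
Proof.
move=> /countable_injP[f fi] x0.
(* Numbers that are not values of [f] are sent to the default 0, which lies below [x]. *)
exists (fun n => xget 0%:O [set y | y < x /\ f y = n]); split=> [n|y yx].
  by case: xgetP => [y _ []|].
exists (f y); case: xgetP => [z _ [zx fzy]|/(_ y)[]//].
by apply: fi; rewrite ?inE.
Qed.

Lemma countable_lto (x y : Ord) : y <= x -> countable [set z | z < x] -> countable [set z | z < y].
Proof.
move=> yx; apply: sub_countable; apply: subset_card_le => z /= zy.
exact: lt_le_trans zy yx.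
Qed.

Fixpoint partial_sum (w : nat -> Ord) (n : nat) : Ord :=
  if n is n'.+1 then partial_sum w n' + w n' else 0%:O.

Lemma partial_sum_le w n m : (n <= m)%N -> partial_sum w n <= partial_sum w m.
Proof.
elim: m => [|m IH]; first by rewrite leqn0 => /eqP ->.
rewrite leq_eqVlt => /predU1P[->//|/IH/le_trans]; apply; exact: leo_addl.
Qed.

(** The exponents are running maxima of an enumeration [q] of [d]: from index [N] on each term is at
    least [omega^ (q N)], so the sums pass all its finite multiples. *)
Lemma cofinal_omega_exp d : 0%:O < d -> countable [set z | z < d] ->
  exists e : nat -> Ord, let s := partial_sum (fun n => omega^ (e n)) in
    [/\ forall n, e n < d, forall n, s n < omega^ d &
        forall u, u < omega^ d -> exists n, u <= s n].
Proof.
move=> d0 cd; have [q [qd dq]] := countable_enum cd d0.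
pose e n := \big[Order.max/0%:O]_(i < n.+1) q i.
have ed n : e n < d.
  by apply: (big_ind (fun z => z < d)) => // u v ud vd; rewrite gt_max ud.
pose s := partial_sum (fun n => omega^ (e n)).
exists e; split => //.
  elim=> [|n IH] /=; first exact: omega_exp_gt0.
  by apply: addo_lt_omega_exp => //; exact: omega_exp_lt.
move=> u /lto_omega_exp[->|[h /dq[N <-] [j uj]]]; first by exists 0; exact: le0o.
exists (N + j)%N; apply: le_trans (ltW uj) _.
elim: j {uj} => [|j IH]; first by rewrite mulon0 le0o.
rewrite mulonS addnS /=; apply: addo_le2 => //; apply: omega_exp_le.
have Nj : (N < (N + j).+1)%N by rewrite ltnS leq_addr.
exact: (le_bigmax_cond _ (fun i : 'I__ => q i) (j := Ordinal Nj)).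
Qed.

(** Choose points of [X] converging to [x], the [n]-th of rank at least [e n]. By induction each
    ends a copy of [omega^ (e n)]; these copies are concatenated, their total lengths [s n] being
    cofinal in [omega^ d]. *)
Lemma accum_normal (X : set Ord) (d x xi : Ord) :
  countable [set y | y < x] -> accum X d x -> xi < x ->
  exists F, [/\ normal_on (omega^ d) F, F (omega^ d) = x &
    forall u, 0%:O < u -> u < omega^ d -> X (F u) /\ xi < F u].
Proof.
elim/ord_ind: d x xi => d IH x xi cx Hx xix.
have [d0|d0] := eqVneq d 0%:O.
  have no u : 0%:O < u -> ~ u < 1%:O by move=> u0 /lto1 uE; rewrite uE ltxx in u0.
  rewrite d0 omega_exp0; exists (fun=> x); split => //; last by move=> u /no.
  split=> [u v /no u0 uv v1|v eta v0 v1 _]; first by case: u0; exact: lt_le_trans uv v1.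
  by exists 0%:O => // w /no w0 wv; case: w0; exact: lt_le_trans wv v1.
move: d0; rewrite -gt0o => d0.
have cd : countable [set z | z < d] by apply: countable_lto cx; exact: accum_leo Hx.
have [e] := cofinal_omega_exp d0 cd; set s := partial_sum _ => -[ed sd ds].
have [q [qx xq]] := countable_enum cx (le_lt_trans (le0o xi) xix).
(* Invariant after [n] stages: a map on []0, s n]] together with a bound below [x] for its
   values. *)
pose P n (st : (Ord -> Ord) * Ord) := [/\ st.2 < x, xi <= st.2, normal_on (s n) st.1 &
  forall u, 0%:O < u -> u <= s n -> [/\ X (st.1 u), xi < st.1 u & st.1 u <= st.2]].
(* The invariant is a premise inside the existential, so that [choice] yields a function to
   iterate. *)
have step (p : nat * ((Ord -> Ord) * Ord)) : exists st', P p.1 p.2 -> [/\ P p.1.+1 st',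
    forall u, u <= s p.1 -> st'.1 u = p.2.1 u & q p.1 < st'.1 (s p.1.+1)].
  case: p => n [G y] /=.
  have [[/= yx xiy Gn Gv]|nP] := pselect (P n (G, y)); last by exists (G, y).
  have [_ H] := (accumP X d x).1 Hx _ (ed n).
  (* Passing [q n] at stage [n] forces the values to converge to [x]. *)
  have [|z [Xz]] := H (Order.max y (q n)); first by rewrite gt_max yx qx.
  rewrite gt_max => /andP[yz qz] zx Hz.
  have [F [Fn Fz Fv]] := IH _ (ed n) z y (countable_lto (ltW zx) cx) Hz yz.
  have Fv' v : 0%:O < v -> v <= omega^ (e n) -> [/\ X (F v), y < F v & F v <= z].
    move=> v0; rewrite le_eqVlt => /predU1P[->|ve]; first by rewrite Fz.
    by have [XF yF] := Fv _ v0 ve; split => //; rewrite -Fz; apply/ltW; case: Fn => Fm _; exact: Fm.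
  exists (cat_fun (s n) G F, z) => _; split => //=.
  - split => //=.
    + exact: le_trans xiy (ltW yz).
    + apply: normal_on_cat => // u v u0 us v0 ve; have [_ _ Gy] := Gv u u0 us.
      by have [_ yF _] := Fv' v v0 ve; exact: le_lt_trans Gy yF.
    + move=> u u0 /(cat_fun_cases u0)[us|[v [v0 ve ->]]].
        rewrite cat_funl //; have [XG xiG Gy] := Gv u u0 us.
        by split => //; exact: le_trans Gy (ltW yz).
      rewrite cat_funr //; have [XF yF Fle] := Fv' v v0 ve.
      by split => //; exact: le_lt_trans xiy yF.
  - by move=> u us; rewrite cat_funl.
  - by rewrite cat_funr ?omega_exp_gt0 // Fz.
have [f Hf] := choice step.
pose st := nat_rect (fun=> ((Ord -> Ord) * Ord)%type) (id, xi) (fun n p => f (n, p)).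
have st0 : P 0 (st 0).
  split => //=; first exact: normal_on0.
  by move=> u u0; rewrite leNgt u0.
have Pst n : P n (st n) by elim: n => // n Pn; have [] := Hf (n, st n) Pn.
have st_agree n m u : (n <= m)%N -> u <= s n -> (st m).1 u = (st n).1 u.
  move=> + us; elim: m => [|m IHm]; first by rewrite leqn0 => /eqP ->.
  rewrite leq_eqVlt => /predU1P[->//|nm].
  have [_ E _] := Hf (m, st m) (Pst m); rewrite -IHm // -E //.
  by apply: le_trans us _; exact: partial_sum_le.
have ds' u : exists n, u < omega^ d -> u <= s n.
  have [/ds[n us]|ud] := pselect (u < omega^ d); first by exists n.
  by exists 0.
have [N HN] := choice ds'.
(* The stages agree where they overlap, so any stage reaching [u] gives the value. *)
pose F u := if u < omega^ d then (st (N u)).1 u else x.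
have FE n u : u <= s n -> F u = (st n).1 u.
  move=> us; have ud := le_lt_trans us (sd n); rewrite /F ud.
  by case: (leqP n (N u)) => nN; [exact: st_agree|apply/esym/st_agree; [exact: ltnW|exact: HN]].
have Flt u : 0%:O < u -> u < omega^ d -> [/\ X (F u), xi < F u & F u < x].
  move=> u0 /ds[n us]; rewrite (FE n) //; have [stx _ _ H] := Pst n.
  by have [XG xiG Gy] := H u u0 us; split => //; exact: le_lt_trans Gy stx.
have Fx : F (omega^ d) = x by rewrite /F ltxx.
exists F; split => //; last by move=> u u0 /(Flt u u0)[].
split=> [u v u0 uv|v eta v0]; rewrite le_eqVlt => /predU1P[vE|vd].
- by rewrite vE Fx; rewrite vE in uv; have [] := Flt u u0 uv.
- have [n vs] := ds v vd; rewrite (FE n v vs) (FE n u (ltW (lt_le_trans uv vs))).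
  by have [_ _ [stm _] _] := Pst n; exact: stm.
- rewrite vE Fx => /xq[n <-]; exists (s n.+1) => // w sw wd.
  have [_ _ qn] := Hf (n, st n) (Pst n).
  apply: lt_trans (qn) _; rewrite -[ltLHS]/((st n.+1).1 (s n.+1)) -(FE n.+1) //.
  have [m wm] := ds w wd; rewrite (FE m w wm) (FE m (s n.+1) (ltW (lt_le_trans sw wm))).
  have [_ _ [stm _] _] := Pst m; apply: stm => //.
  by apply: lt_le_trans (leo_addr _ _); exact: omega_exp_gt0.
- have [n vs] := ds v vd; rewrite (FE n v vs); have [_ _ [_ stc] _] := Pst n.
  move=> /(stc _ _ v0 vs)[u uv H]; exists u => // w uw wv.
  by rewrite (FE n w (ltW (lt_le_trans wv vs))) H.
Qed.

(** * The two bounds *)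

Lemma countable_addo a b : countable [set y | y < a] -> countable [set y | y < b] ->
  countable [set y | y < a + b].
Proof.
move=> ca cb; have : countable (\bigcup_(i in [set: bool])
    (if i then [set y | y < a] else [set a + y | y in [set y | y < b]])).
  apply: bigcup_countable => // -[] _ //.
  by apply: sub_countable cb; exact: card_image_le.
apply: sub_countable; apply: subset_card_le => y /= /lto_addE[ya|[e eb ->]].
  by exists true.
by exists false => //; exists e.
Qed.

Lemma countable_mulon a n : countable [set y | y < a] -> countable [set y | y < a * n%:O].
Proof.
move=> ca; elim: n => [|n IH]; last by rewrite mulonS; exact: countable_addo.
have -> : [set y | y < a * 0%:O] = set0 :> set Ord.
  by rewrite mulo0; apply/seteqP; split => y //=; rewrite ltNge le0o.
exact: countable0.
Qed.

Lemma countable_omega_exp a : countable [set y | y < a] -> countable [set y | y < omega^ a].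
Proof.
elim/ord_ind: a => a IH ca.
have : countable (\bigcup_(n in [set: nat]) \bigcup_(h in [set h | h < a])
    [set y | y < omega^ h * n.+1%:O]).
  apply: bigcup_countable => // n _; apply: bigcup_countable => // h ha.
  by apply: countable_mulon; apply: IH => //; apply: countable_lto ca; exact: ltW.
have [->|a0] := eqVneq a 0%:O.
  move=> _; rewrite omega_exp0; apply: (sub_countable _ (countable1 0%:O)).
  by apply: subset_card_le => y /= /lto1.
apply: sub_countable; apply: subset_card_le => y /= /lto_omega_exp[->|[h ha [n yn]]].
  exists 0 => //; exists 0%:O; first by rewrite /= gt0o.
  by rewrite /= mulon1 omega_exp_gt0.
exists n => //; exists h => //=; apply: lt_le_trans yn _; exact: mulon_le.
Qed.

(** The rank [r] is injective on each part, so [s] is a countable union of countable sets. *)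
Lemma countable_splits (I : countType) s (a : I -> Ord) :
  splits s a -> (forall i, countable [set y | y < a i]) -> countable [set y | y < s].
Proof.
move=> [phi [r H]] ca.
have : countable (\bigcup_(i in [set: I]) [set y | y < s /\ phi y = i]).
  apply: bigcup_countable => // i _.
  have /countable_injP[f fi] := ca i; apply/countable_injP; exists (f \o r).
  move=> y z; rewrite !inE => -[ys yi] [zs zi] /fi E.
  have {E} : r y = r z.
    by apply: E; rewrite inE /= -?yi; [|rewrite yi -zi]; have [] := H _ ys; have [] := H _ zs.
  have [_ my] := H _ ys; have [_ mz] := H _ zs.
  have [yz|zy|//] := ltgtP y z.
    by move=> E; move: (mz y yz); rewrite yi zi E ltxx => /(_ erefl).
  by move=> E; move: (my z zy); rewrite yi zi E ltxx => /(_ erefl).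
by apply: sub_countable; apply: subset_card_le => y /= ys; exists (phi y).
Qed.

(** * Upper bound *)

Lemma normal_extend (X : set Ord) a n G y z :
  countable [set u | u < z] -> normal_on (omega^ a * n%:O) G ->
  (forall u, 0%:O < u -> u <= omega^ a * n%:O -> X (G u) /\ G u <= y) ->
  y < z -> accum X a z ->
  exists G', [/\ normal_on (omega^ a * n.+1%:O) G', G' (omega^ a * n.+1%:O) = z &
    forall u, 0%:O < u -> u < omega^ a * n.+1%:O -> X (G' u) /\ G' u <= z].
Proof.
move=> cz Gn Gv yz Hz; have [F [Fn Fz Fv]] := accum_normal cz Hz yz.
have e0 := omega_exp_gt0 a.
exists (cat_fun (omega^ a * n%:O) G F); rewrite mulonS; split.
- apply: normal_on_cat => // u v u0 un v0.
  have [_ Gy] := Gv u u0 un; rewrite le_eqVlt => /predU1P[->|va].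
    by rewrite Fz; exact: le_lt_trans Gy yz.
  by have [_ yF] := Fv v v0 va; exact: le_lt_trans Gy yF.
- by rewrite cat_funr.
- move=> u u0 un; have [un'|[v [v0 _ uE]]] := cat_fun_cases u0 (ltW un).
    by rewrite cat_funl //; have [XG Gy] := Gv u u0 un'; split => //; exact: le_trans Gy (ltW yz).
  have va : v < omega^ a by move: un; rewrite uE lto_addr2.
  rewrite uE cat_funr //; have [XF _] := Fv v v0 va; split => //.
  by rewrite -Fz; apply/ltW; case: Fn => Fm _; exact: Fm.
Qed.

Lemma normal_extend_in (X : set Ord) a n G y z :
  countable [set u | u < z] -> normal_on (omega^ a * n%:O) G ->
  (forall u, 0%:O < u -> u <= omega^ a * n%:O -> X (G u) /\ G u <= y) ->
  y < z -> accum X a z -> X z ->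
  exists G', normal_on (omega^ a * n.+1%:O) G' /\
    forall u, 0%:O < u -> u <= omega^ a * n.+1%:O -> X (G' u) /\ G' u <= z.
Proof.
move=> cz Gn Gv yz Hz Xz; have [G' [G'n G'z G'v]] := normal_extend cz Gn Gv yz Hz.
exists G'; split => // u u0; rewrite le_eqVlt => /predU1P[->|]; last exact: G'v.
by rewrite G'z.
Qed.

(** Points of [X] of rank at least [a] accumulate at [x], so copies of [omega^ a] can be appended
    any number of times before reaching [x]. *)
Lemma accumS_normal (X : set Ord) a x n :
  countable [set u | u < x] -> accum X (a + 1%:O) x ->
  exists G, normal_on (omega^ a * n%:O) G /\
    forall u, 0%:O < u -> u <= omega^ a * n%:O -> X (G u).
Proof.
move=> cx /accumP/(_ a)[]; first exact/lt_succoP.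
move=> x0 Hx; suff [G [y [_ Gn Gv]]] : exists G y, [/\ y < x, normal_on (omega^ a * n%:O) G &
    forall u, 0%:O < u -> u <= omega^ a * n%:O -> X (G u) /\ G u <= y].
  by exists G; split => // u u0 /(Gv u u0)[].
elim: n => [|n [G [y [yx Gn Gv]]]].
  exists id, 0%:O; rewrite mulon0; split => //; first exact: normal_on0.
  by move=> u u0; rewrite leNgt u0.
have [z [Xz yz zx Hz]] := Hx y yx.
have [G' [G'n G'v]] := normal_extend_in (countable_lto (ltW zx) cx) Gn Gv yz Hz Xz.
by exists G', z.
Qed.

(** If every [i] occurred at most [m_ i - 1] times, there would be one position too few. *)
Lemma pigeonhole_sum k (m_ : 'I_k -> nat) (psi : nat -> 'I_k) :
  (forall i, (0 < m_ i)%N) ->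
  exists i, (m_ i <= \sum_(j < (\sum_(i < k) (m_ i - 1) + 1)%N) (psi j == i))%N.
Proof.
move=> m0; apply: contrapT => H.
set m := (\sum_(i < k) (m_ i - 1) + 1)%N in H.
have : (m <= \sum_(i < k) (m_ i - 1))%N; last by rewrite /m addn1 ltnn.
have {1}-> : m = (\sum_(i < k) \sum_(j < m) (psi j == i))%N.
  rewrite exchange_big /= -[LHS]card_ord -sum1_card; apply: eq_bigr => j _.
  by rewrite (bigD1 (psi j)) //= eqxx big1 // => i /negbTE; rewrite eq_sym => ->.
apply: leq_sum => i _; rewrite leqNgt; apply/negP => lt_i; apply: H; exists i.
by apply: leq_trans lt_i; rewrite subn1 prednK.
Qed.

Lemma normal_homogeneous k (a : 'I_k.+1 -> Ord) (m_ : 'I_k.+1 -> nat)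
    (C : 'I_k.+1 -> set Ord) :
  (forall i, countable [set y | y < a i]) -> (forall i, (0 < m_ i)%N) ->
  let alpha := \big[natural_sum/0%:O]_(i < k.+1) a i in
  let m := (\sum_(i < k.+1) (m_ i - 1) + 1)%N in
  (forall y, y < omega^ alpha * m.+1%:O -> exists i, C i y) ->
  exists i G, normal_on (omega^ (a i) * (m_ i).+1%:O) G /\
    forall u, 0%:O < u -> u < omega^ (a i) * (m_ i).+1%:O -> C i (G u).
Proof.
move=> ca m0 alpha m cover; set b := omega^ alpha * _ in cover.
have cb : countable [set y | y < b].
  by apply/countable_mulon/countable_omega_exp/(countable_splits (big_natural_sum_splits a)).
(* The point [p m] is [b] itself, the end point outside the space. *)
pose p j := omega^ alpha * j.+1%:O.
have pb j : (j <= m)%N -> p j <= b by move=> jm; exact: mulon_le.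
have [[j [i [jm lt_i]]]|none] := pselect (exists j i, (j <= m)%N /\ a i < cbrank (C i) (p j)).
  have [||G [Gn Gv]] := @accumS_normal (C i) (a i) (p j) (m_ i).+1.
  - exact: countable_lto (pb j jm) cb.
  - by apply/accum_cbrank/succo_leP.
  - by exists i, G; split => // u u0 /ltW; exact: Gv.
have rank_le i j : (j <= m)%N -> cbrank (C i) (p j) <= a i.
  by move=> jm; rewrite leNgt; apply/negP => lt_i; apply: none; exists j, i.
have rank_ge i j : (j <= m)%N -> accum (C i) (a i) (p j).
  move=> jm; apply/accum_cbrank; rewrite leNgt; apply/negP => lt_i.
  (* With one rank too small and the others at most [a i'], the natural sum would be below
     [alpha]. *)
  have := @cbrank_cover _ C b alpha (omega^ alpha * j%:O) cover.
  rewrite -mulonS => /(_ (pb j jm)); apply/negP; rewrite -ltNge.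
  by apply: (big_natural_sum_lt (i0 := i)) => // i'; exact: rank_le.
have Hex (j : nat) : exists i, (j < m)%N -> C i (p j).
  have [jm|jm] := ltnP j m; last by exists ord0.
  have [|i Ci] := cover (p j); last by exists i.
  by apply: mulon_lt; rewrite ?omega_exp_gt0.
have [psi Hpsi] := choice Hex.
have [i im] := pigeonhole_sum psi m0.
(* Walk through the first [m] points, appending a copy of [omega^ (a i)] at each one of colour
   [i]. *)
have [G [Gn Gv]] : exists G,
    normal_on (omega^ (a i) * (\sum_(j < m) (psi j == i))%N%:O) G /\
    forall u, 0%:O < u -> u <= omega^ (a i) * (\sum_(j < m) (psi j == i))%N%:O ->
      C i (G u) /\ G u <= omega^ alpha * m%:O.
  elim: {-2}m (leqnn m) => [|n IH] nm.
    exists id; rewrite big_ord0 mulon0; split; first exact: normal_on0.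
    by move=> u u0; rewrite leNgt u0.
  have [G [Gn Gv]] := IH (ltnW nm); rewrite big_ord_recr /=.
  have [ni|ni] := eqVneq (psi n) i; last first.
    exists G; rewrite addn0; split => // u u0 /(Gv u u0)[Ci Gle]; split => //.
    by apply: le_trans Gle _; exact: mulon_le.
  rewrite addn1; apply: (normal_extend_in _ Gn Gv).
  - by apply: countable_lto cb; apply: pb; exact: ltnW.
  - by apply: mulon_lt; rewrite ?omega_exp_gt0.
  - by apply: rank_ge; exact: ltnW.
  - by rewrite -ni; exact: Hpsi.
have le_top := mulon_le (omega^ (a i)) im.
(* The last copy converges to [b], which is why the values are controlled only below the end of the
   domain. *)
have [|||||G' [G'n _ G'v]] := @normal_extend (C i) (a i) (m_ i) G (omega^ alpha * m%:O) b.
- exact: cb.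
- exact: normal_on_le Gn.
- by move=> u u0 um; apply: Gv => //; exact: le_trans um le_top.
- by apply: mulon_lt; rewrite ?omega_exp_gt0.
- exact: (rank_ge i m).
by exists i, G'; split => // u u0 /(G'v u u0)[].
Qed.

(** A segment starts at 0 while [normal_on] concerns positive arguments; hence the shift [1 + x],
    for which [betaP] makes room. *)
Lemma top_arrow_upper k (a : 'I_k.+1 -> Ord) (m_ : 'I_k.+1 -> nat) (beta : 'I_k.+1 -> Ord) :
  (forall i, countable [set y | y < a i]) -> (forall i, (0 < m_ i)%N) ->
  (forall i x, x < beta i -> 1%:O + x < omega^ (a i) * (m_ i).+1%:O) ->
  top_arrow (omega^ (\big[natural_sum/0%:O]_(i < k.+1) a i) *
    (\sum_(i < k.+1) (m_ i - 1) + 1).+1%:O) beta.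
Proof.
move=> ca m0 betaP; set b := _ * _; apply/top_arrowP => col.
pose C i : set Ord := [set y | exists x : segment b, val x = y /\ col x = i].
have [|i [G [[Gm Gc] GC]]] := @normal_homogeneous k a m_ C ca m0.
  move=> y yb; exists (col (exist (fun u : Ord => u < b) _ yb)).
  by exists (exist (fun u : Ord => u < b) _ yb).
have pos x : 0%:O < 1%:O + x by apply: lt_le_trans (leo_addl _ _); rewrite lt_nato.
have GC' x : x < beta i -> C i (G (1%:O + x)) by move=> xb; apply: GC => //; exact: betaP.
have [f fE] : exists f : segment (beta i) -> segment b, forall x, val (f x) = G (1%:O + val x).
  apply: (@exists_segment_map _ _ (fun x => G (1%:O + x))) => x /GC'[y [<- _]].
  exact: (valP y).
exists i, f; split.
  apply: (monotone_embedding fE) => [u v uv vb|v eta v0 vb eta_lt].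
    by apply: (Gm (1%:O + u) (1%:O + v)); [exact: pos|rewrite lto_addr2|exact: ltW (betaP i v vb)].
  have [u uv H] := Gc (1%:O + v) eta (pos v) (ltW (betaP i v vb)) eta_lt.
  move: uv H => /lto_addE[/lto1 -> H|[e ev ->] H].
    by exists 0%:O => // w _ wv; apply: H; rewrite ?lto_addr2.
  by exists e => // w ew wv; apply: H; rewrite lto_addr2.
move=> x; have [y [yE <-]] := GC' _ (valP x).
by congr col; apply: val_inj; rewrite fE.
Qed.

(** * Lower bound *)

Lemma seq_of_multiplicities k (n : 'I_k -> nat) : exists s : seq 'I_k,
  size s = (\sum_(i < k) n i)%N /\ forall i, count_mem i s = n i.
Proof.
exists (flatten [seq nseq (n i) i | i <- enum 'I_k]); split=> [|i].
  rewrite size_flatten /shape -map_comp sumnE big_map big_enum /=.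
  by apply: eq_bigr => i _; rewrite size_nseq.
rewrite count_flatten -map_comp sumnE big_map big_enum /= (bigD1 i) //=.
rewrite count_nseq /= eqxx mul1n big1 ?addn0 // => j ji.
by rewrite count_nseq /= (negbTE ji).
Qed.

Lemma leq_count_mem_inj (T : eqType) (x x0 : T) (s : seq T) n (t : 'I_n -> nat) :
  injective t -> (forall j, (t j < size s)%N /\ nth x0 s (t j) = x) ->
  (n <= count_mem x s)%N.
Proof.
move=> ti Ht; pose h j : 'I_(size s) := Ordinal (Ht j).1.
have hi : injective h by move=> i j [] /ti.
rewrite -sum1_count (big_nth x0) big_mkord sum1_card -[leqLHS]card_ord -(card_codom hi).
apply: subset_leq_card; apply/fintype.subsetP => _ /codomP[j ->].
by rewrite unfold_in; apply/eqP; exact: (Ht j).2.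
Qed.

(** A nonzero remainder modulo [omega^ a] ends in a smaller power and forces a rank below [a]; the
    point 0 has rank 0. *)
Lemma cbrank_ge_omega_exp a n x : 0%:O < a -> x < omega^ a * n%:O ->
  a <= cbrank setT x -> exists j, (j.+1 < n)%N /\ x = omega^ a * j.+1%:O.
Proof.
move=> a0 /lto_mulon[j [e [jn ea xE]]].
have [e0|] := eqVneq e 0%:O; last first.
  rewrite -gt0o => /omega_exp_last[e' [h eE]].
  rewrite xE eE addoA => /le_trans/(_ (cbrank_setT_le _ _)); rewrite leNgt => /negP[].
  by apply: omega_exp_lt_inv; apply: le_lt_trans ea; rewrite eE leo_addr.
rewrite xE e0 addo0; case: j jn {xE} => [_|j jn _]; last by exists j.
have [/accum_leo r0 _] := cbrankP setT 0%:O; rewrite mulon0.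
by move=> /le_trans/(_ r0); rewrite leNgt a0.
Qed.

(** The points of rank at least [a] in increasing order. For [a = 0] every point counts, including
    0, which the first formula would miss. *)
Definition peak a (j : nat) : Ord := if 0%:O < a then omega^ a * j.+1%:O else j%:O.

Lemma peak_inj a : injective (peak a).
Proof.
move=> i j; rewrite /peak; case: ifP => _; last exact: nato_inj.
have [ij|ji|//] := ltngtP i j => E.
  have : omega^ a * i.+1%:O < omega^ a * j.+1%:O by apply: mulon_lt; rewrite ?omega_exp_gt0.
  by rewrite E ltxx.
have : omega^ a * j.+1%:O < omega^ a * i.+1%:O by apply: mulon_lt; rewrite ?omega_exp_gt0.
by rewrite E ltxx.
Qed.

(* A point of rank [d < alpha] receives the colour of [d] in a partition of [alpha]
   into sets of order types [a i], and the other points, of which there are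
   [\sum_i (m_ i - 1)], receive the colour [i] at most [m_ i - 1] times. *)
Lemma top_arrow_lower k (a : 'I_k.+1 -> Ord) (m_ : 'I_k.+1 -> nat) (beta : 'I_k.+1 -> Ord) b :
  let alpha := \big[natural_sum/0%:O]_(i < k.+1) a i in
  0%:O < alpha -> (forall i, (0 < m_ i)%N) ->
  (forall i j, (j < m_ i)%N -> peak (a i) j < beta i) ->
  b <= omega^ alpha * (\sum_(i < k.+1) (m_ i - 1) + 1)%N%:O ->
  ~ top_arrow b beta.
Proof.
move=> alpha alpha0 m0 betaP bm /top_arrowP.
have [phi [r Hr]] := big_natural_sum_splits a; rewrite -/alpha in Hr.
have [s [ss sc]] := seq_of_multiplicities (fun i => (m_ i - 1)%N).
pose idx x := xget 0 [set j | x = omega^ alpha * j.+1%:O].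
have idxE j : idx (omega^ alpha * j.+1%:O) = j.
  rewrite /idx; case: xgetP => [j' _ E|/(_ j)[]//].
  by apply: (@peak_inj alpha); rewrite /peak alpha0.
pose col (x : segment b) : 'I_k.+1 :=
  if cbrank setT (val x) < alpha then phi (cbrank setT (val x))
  else nth ord0 s (idx (val x)).
move=> /(_ col)[i [f [[fi fc _] fcol]]].
(* Points ending in each smaller power accumulate at [y]. Near [f y] the ranks are smaller, and as
   the colour is always [i], [r] drops strictly. *)
have claim d (y : segment (beta i)) : d = 0%:O \/ (exists u, val y = u + omega^ d) ->
    cbrank setT (val (f y)) < alpha -> d <= r (cbrank setT (val (f y))).
  elim/ord_ind: d y => d IH y [->|[u yE]] fy; first exact: le0o.
  apply: leo_sub => e ed.
  pose A : set (segment b) :=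
    [set w | w = f y \/ cbrank setT (val w) < cbrank setT (val (f y))].
  have /fc/nbhs_segmentP[_ H] : nbhs (f y) A.
    apply/nbhs_segmentP; split; first by left.
    move=> fy0; have [xi xifx K] := cbrank_nbhs setT fy0; exists xi => // z xiz zf.
    by right; have [_] := K _ xiz zf; exact.
  have [|xi] := H _; first by rewrite yE; exact: lt_le_trans (omega_exp_gt0 d) (leo_addr _ _).
  rewrite yE => xiy {}H; have [v [xiv vy]] := omega_exp_accum ed xiy.
  have vb : v + omega^ e < beta i by apply: lt_trans vy _; rewrite -yE; exact: (valP y).
  pose z : segment (beta i) := exist (fun w : Ord => w < beta i) _ vb.
  have [/fi zy|zy] := H z xiv vy; first by move: vy; rewrite -yE -zy ltxx.
  have fz := lt_trans zy fy.
  apply: (@le_lt_trans _ _ (r (cbrank setT (val (f z))))).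
    by apply: IH => //; right; exists v.
  have [_] := Hr _ fy; apply => //.
  by move: (fcol z) (fcol y); rewrite /col fz fy => -> ->.
(* By [claim], a peak sent to a rank below [alpha] would have [r] at least [a i], against the bound
   on [r]. *)
have top (j : 'I_(m_ i)) : exists t, [/\ (t < size s)%N, nth ord0 s t = i &
    exists y : segment (beta i), val y = peak (a i) j /\ val (f y) = omega^ alpha * t.+1%:O].
  have pj := betaP i j (ltn_ord j).
  pose y : segment (beta i) := exist (fun w : Ord => w < beta i) _ pj.
  have [fy|fy] := ltP (cbrank setT (val (f y))) alpha.
    have [rlt _] := Hr _ fy; have := fcol y; rewrite /col fy => phi_i.
    move: rlt; rewrite phi_i ltNge claim //.
    rewrite /y /= /peak; have [_|] := ltP 0%:O (a i); first by right; rewrite mulonS; eexists.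
    by move=> ai0; left; apply/le_anti; rewrite ai0 le0o.
  have [t [tm fE]] := cbrank_ge_omega_exp alpha0 (lt_le_trans (valP (f y)) bm) fy.
  exists t; split; first by rewrite ss -ltnS -(addn1 (\sum_(_ < _) _)%N).
    by have := fcol y; rewrite /col ltNge fy /= fE idxE.
  by exists y.
have [t Ht] := choice top.
have : (m_ i <= count_mem i s)%N.
  apply: (@leq_count_mem_inj _ i ord0 s _ t); last by move=> j; have [] := Ht j.
  move=> j j' tj; have [_ _ [y [yE fyE]]] := Ht j; have [_ _ [y' [y'E fy'E]]] := Ht j'.
  apply/val_inj/(@peak_inj (a i)); rewrite -yE -y'E; congr val.
  by apply/fi/val_inj; rewrite fyE fy'E tj.
by rewrite sc -ltnS subn1 prednK // ltnn.
Qed.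

Theorem theorem4p11 (k : nat) (k_gt0 : (0 < k)%N) (l : 'I_k)
  (alpha_ : 'I_k -> Ord) (m_ : 'I_k -> nat)
  (alpha_omega1 : forall i, in_omega1 (alpha_ i))
  (alpha_gt0 : forall i : 'I_k, (i <= l)%N -> 0%:O < alpha_ i)
  (m_gt0 : forall i, (0 < m_ i)%N) :
  let beta_ (i : 'I_k) : Ord :=
    if (i <= l)%N then omega^ (alpha_ i) * (m_ i + 1)%N%:O
    else bar_omega (alpha_ i) (m_ i) in
  let alpha : Ord := \big[natural_sum/0%:O]_(i < k) alpha_ i in
  let m : nat := (\sum_(i < k) (m_ i - 1) + 1)%N in
  is_Ptop beta_ (omega^ alpha * m%:O + 1%:O) \/
  is_Ptop beta_ (omega^ alpha * (m + 1)%N%:O).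
Proof.
case: k k_gt0 l alpha_ m_ alpha_omega1 alpha_gt0 m_gt0 => // k _ l a m_ ca a_gt0 m_gt0.
move=> beta alpha m.
have alpha0 : 0%:O < alpha.
  apply: le_lt_trans (le0o (\big[natural_sum/0%:O]_(i < k.+1) 0%:O)) _.
  by apply: (big_natural_sum_lt (i0 := l)) => [i|]; [exact: le0o|exact: a_gt0].
have peak_lt i j : (j < m_ i)%N -> peak (a i) j < beta i.
  rewrite /peak /beta /bar_omega => jm; have [il|il] := leqP i l.
    by rewrite a_gt0 // addn1; apply: mulon_lt; rewrite ?omega_exp_gt0.
  have [_|_] := ltP 0%:O (a i); last by rewrite lt_nato.
  by apply/lt_succoP; exact: mulon_le.
(* For [a i > 0] the shift is absorbed by [omega^ (a i)]; for [a i = 0] the factor [m_ i + 1] leaves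
   one extra place. *)
have room i x : x < beta i -> 1%:O + x < omega^ (a i) * (m_ i).+1%:O.
  have lt1 : 0%:O < a i -> 1%:O < omega^ (a i).
    by move=> ai0; rewrite -omega_exp0; exact: omega_exp_lt.
  rewrite /beta /bar_omega; have [il xb|il] := leqP i l.
    by rewrite -(addo_omega_exp_mulon (lt1 (a_gt0 i il)) (ltn0Sn _)) lto_addr2 -addn1.
  have [ai0 /lt_succoP xb|ai0 xm] := ltP 0%:O (a i).
    apply: (@le_lt_trans _ _ (omega^ (a i) * (m_ i)%:O)); last first.
      by apply: mulon_lt; rewrite ?omega_exp_gt0.
    by rewrite -(addo_omega_exp_mulon (lt1 ai0) (m_gt0 i)) leo_addr2.
  have -> : a i = 0%:O by apply/le_anti; rewrite ai0 le0o.
  have one_mul n : omega^ 0%:O * n%:O = n%:O.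
    by elim: n => [|n IH]; rewrite ?mulo0 // mulonS IH omega_exp0 -natoS.
  by rewrite one_mul -(add1on (m_ i)) lto_addr2.
have upper : top_arrow (omega^ alpha * (m + 1)%N%:O) beta.
  by rewrite addn1; exact: top_arrow_upper.
have lower b : top_arrow b beta -> omega^ alpha * m%:O + 1%:O <= b.
  move=> bP; apply/succo_leP; rewrite ltNge; apply/negP => bm.
  exact: (top_arrow_lower alpha0 m_gt0 peak_lt bm).
(* A suitable [b] below the upper bound is [omega^ alpha * m + 1 + c] with [c < omega^ alpha]; it
   embeds in [omega^ alpha * m + 1], which is then suitable too. *)
have [[b bP blt]|none] := pselect (exists2 b, top_arrow b beta & b < omega^ alpha * (m + 1)%N%:O).
  left; split => //; have [c bE] := leo_exists_sub (lower b bP).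
  have c_lt : c < omega^ alpha.
    move: blt; rewrite bE addn1 mulonS -addoA lto_addr2; apply: le_lt_trans.
    exact: leo_addr.
  have m_pos : (0 < m)%N by rewrite /m addn1.
  have [||| f ef] := @swap_embedding c (omega^ alpha * m%:O).
  - by rewrite -(mulon0 (omega^ alpha)); apply: mulon_lt; rewrite ?omega_exp_gt0.
  - apply: addo_omega_exp_mulon => //; apply: addo_lt_omega_exp => //.
    by rewrite -omega_exp0; exact: omega_exp_lt.
  - by apply: lt_le_trans c_lt _; rewrite -{1}(mulon1 (omega^ alpha)); exact: mulon_le.
  by apply: (top_arrow_embedding ef); rewrite -bE.
right; split => // b bP; rewrite leNgt; apply/negP => blt.
by apply: none; exists b.
Qed.
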